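(* For every positive real number $M$ there exists a real number $R>M$ such that: (i) there are infinitely many pairwise distinct imaginary biquadratic fields whose regulator equals $R$; (ii) there are infinitely many pairwise distinct pairs $(K_1,K_2)$ of distinct imaginary biquadratic fields $K_1\neq K_2$ such that $\operatorname{disc}(K_1)=\operatorname{disc}(K_2)$ and $\operatorname{reg}(K_1)=\operatorname{reg}(K_2)=R$.
   Context: Number fields are subfields of $\mathbb{C}$ of finite degree over $\mathbb{Q}$. A biquadratic field is a field of the form $\mathbb{Q}(\sqrt{a},\sqrt{b})$ of degree $4$ over $\mathbb{Q}$ (a Galois quartic field with group $\mathbb{Z}/2\times\mathbb{Z}/2$); it is imaginary if it is not contained in $\mathbb{R}$. For a number field $K$, $\operatorname{disc}(K)$ denotes its discriminant and $\operatorname{reg}(K)$ its regulator. *)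

(* Defs.v *)
From HB Require Import structures.
From mathcomp Require Import all_boot all_order all_algebra.
From mathcomp Require Import complex.
From mathcomp Require Import all_classical all_reals all_analysis.

Set Implicit Arguments.
Unset Strict Implicit.
Unset Printing Implicit Defensive.

Import Order.TTheory GRing.Theory Num.Theory.
Local Open Scope classical_set_scope.
Local Open Scope ring_scope.

(* The complex numbers are [R[i]] with [R : realType]; a number field is a
   subset of [R[i]], so that distinctness of fields is distinctness of sets. *)

Definition is_subfield (R : realType) (K : set R[i]) : Prop :=
  GRing.divring_closed [in K].

Definition is_basis (A : nzRingType) (R : realType) (f : A -> R[i])
    (S : set R[i]) (n : nat) (e : 'I_n -> R[i]) : Prop :=
  (forall i, S (e i)) /\
  forall x, S x -> exists! c : {ffun 'I_n -> A}, x = \sum_(i < n) f (c i) * e i.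

Definition has_degree (R : realType) (K : set R[i]) (n : nat) : Prop :=
  exists e : 'I_n -> R[i], is_basis ratr K e.

Definition number_field (R : realType) (K : set R[i]) : Prop :=
  is_subfield K /\ exists n, has_degree K n.

(* The field Q(x, y). *)
Definition adjoin2 (R : realType) (x y : R[i]) : set R[i] :=
  smallest (@is_subfield R) [set x; y].

Definition biquadratic (R : realType) (K : set R[i]) : Prop :=
  number_field K /\ has_degree K 4 /\
  exists a b : rat, K = adjoin2 (sqrtC (ratr a)) (sqrtC (ratr b)).

Definition imaginary_biquadratic (R : realType) (K : set R[i]) : Prop :=
  biquadratic K /\ ~ (forall x, K x -> x \is Num.real).

Definition integers_of (R : realType) (K : set R[i]) : set R[i] :=
  [set x | K x /\ integralOver (intr : int -> R[i]) x].

Definition units_of (R : realType) (K : set R[i]) : set R[i] :=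
  [set x | [/\ integers_of K x, x != 0 & integers_of K x^-1]].

Definition roots_of_unity_of (R : realType) (K : set R[i]) : set R[i] :=
  [set x | K x /\ exists2 m, (0 < m)%N & x ^+ m = 1].

(* An embedding K -> C is represented by a total function on C; only its values
   on K are constrained, and embeddings are compared on K only. *)
Definition embedding (R : realType) (K : set R[i]) (s : R[i] -> R[i]) : Prop :=
  [/\ s 1 = 1,
      forall x y, K x -> K y -> s (x + y) = s x + s y &
      forall x y, K x -> K y -> s (x * y) = s x * s y].

Definition embeddings (R : realType) (K : set R[i]) (n : nat)
    (s : 'I_n -> R[i] -> R[i]) : Prop :=
  (forall i, embedding K (s i)) /\
  forall t, embedding K t -> exists! i, forall x, K x -> t x = s i x.

(* One embedding for each archimedean place, i.e. one from each pair of complex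
   conjugate embeddings together with all the real embeddings. *)
Definition arch_places (R : realType) (K : set R[i]) (n : nat)
    (s : 'I_n -> R[i] -> R[i]) : Prop :=
  (forall i, embedding K (s i)) /\
  forall t, embedding K t -> exists! i,
    (forall x, K x -> t x = s i x) \/ (forall x, K x -> t x = (s i x)^*).

Definition local_degree (R : realType) (K : set R[i]) (s : R[i] -> R[i]) : nat :=
  if `[< forall x, K x -> s x \is Num.real >] then 1 else 2.

(* The set below is a singleton for every number field; the default value 0 of
   [xget] is irrelevant. *)
Definition disc (R : realType) (K : set R[i]) : int :=
  xget 0 [set d : int | exists n (e : 'I_n -> R[i]) (s : 'I_n -> R[i] -> R[i]),
    [/\ is_basis (intr : int -> R[i]) (integers_of K) e,
        embeddings K s &
        d%:~R = (\det (\matrix_(i < n, j < n) s i (e j))) ^+ 2]].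

(* Every unit is, in a unique way, a root of unity times a product of integer
   powers of the [u i]. *)
Definition fundamental_units (R : realType) (K : set R[i]) (r : nat)
    (u : 'I_r -> R[i]) : Prop :=
  (forall i, units_of K (u i)) /\
  forall x, units_of K x -> exists! zc : R[i] * {ffun 'I_r -> int},
    roots_of_unity_of K zc.1 /\ x = zc.1 * \prod_(i < r) u i ^ zc.2 i.

(* With r + 1 archimedean places: the absolute value of an r x r minor of the
   r x (r + 1) matrix of logarithms (the last place is dropped; the minors agree
   up to sign because the rows of the full matrix sum to zero). *)
Definition reg (R : realType) (K : set R[i]) : R :=
  xget 0 [set v : R | exists r (u : 'I_r -> R[i]) (s : 'I_r.+1 -> R[i] -> R[i]),
    [/\ fundamental_units K u,
        arch_places K s &
        v = `| \det (\matrix_(i < r, j < r)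
                 ((local_degree K (s (lift ord_max j)))%:R *
                  ln (Normc.normc (s (lift ord_max j) (u i))))) | ]].

(* Main.v *)
From HB Require Import structures.
Require Import Defs.
From mathcomp Require Import all_boot all_order all_algebra all_field perm.
From mathcomp Require Import complex.
From mathcomp Require Import all_classical all_reals all_analysis.
From mathcomp Require Import ring lra zify.
Set Implicit Arguments.
Unset Strict Implicit.
Import Order.TTheory GRing.Theory Num.Theory.
Local Open Scope classical_set_scope.
Local Open Scope ring_scope.

(* For pairwise coprime squarefree [x], [y] = 1 and [z] = 3 modulo 4, the field
   [K(x,y,z)] generated by [al = sqrt(xy)] and [be = sqrt(-xz)] has discriminant
   [(xyz)^2], so that [K(1,xy,z)] and [K(x,y,z)] share it.

   Let [u] be a unit with coordinates [a, b, c, e] in the basis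
   [1, al, be, al*be/x].  Then [|u|^2 + |u|^-2] is twice
   [a^2 + xy b^2 + xz c^2 + yz e^2], and four times each coordinate is an integer.
   If the products [xy], [xz], [yz] exceed 16, this makes [1] and [-1] the only
   units of modulus 1, and it keeps the moduli of the other units far from 1.
   Applied to [u^* / u] it shows that every unit is real or purely imaginary, and
   the latter is excluded because [z^2] would divide 256, the norm of [4u].  So
   the units of [K(x,y,z)] are those of [Q(sqrt(xy))]: with [xy] fixed, the regulator
   does not depend on [z], and it is large when [xy] is. *)

(** * Squarefree numbers and the Pell equation *)

(** The quadratic subfields of [K(x,y,z)] are generated by square roots of [xy], [-xz] and [-yz].
    The congruences make these three numbers 1 modulo 4, so they are the quadratic discriminants,
    and their product [(xyz)^2] depends on [x] and [y] only through [xy].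

    The obstacle is the choice of [xy]. It must split into two factors, both greater than 1 so that
    the two fields differ and both 1 modulo 4 so that the discriminants agree, and its real
    quadratic field needs a visible nontrivial unit. The squarefree part of [L (4L+1)] offers the
    splitting and an explicit Pell solution at once. That solution only shows that the moduli of the
    units form a nontrivial group; the gap around 1 makes this group discrete, hence generated by
    the modulus of one unit.

    [disc] and [reg] are specified through all admissible bases, units, embeddings and places. Each
    computation therefore has two halves: one choice realizes the value, and any other choice yields
    the same value. *)

Definition squarefree (n : nat) := forall v, (v ^ 2 %| n)%N -> v = 1%N.

Lemma squarefree_dvd m n : squarefree n -> (m %| n)%N -> squarefree m.
Proof. by move=> sn mn v /dvdn_trans/(_ mn)/sn. Qed.

Lemma squarefree_prime p : prime p -> squarefree p.
Proof.
move=> pp v; have v_dvd : (v %| v ^ 2)%N by rewrite expnS dvdn_mulr.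
move=> v2; have /(primeP pp).2/orP[/eqP//|/eqP vp] := dvdn_trans v_dvd v2.
have p1 := prime_gt1 pp; have := dvdn_leq (prime_gt0 pp) v2.
by rewrite vp; nia.
Qed.

Lemma squarefree_mul m n : squarefree m -> squarefree n -> coprime m n ->
  squarefree (m * n).
Proof.
move=> sm sn cmn v v2; apply/eqP/negPn/negP => v1.
have v0 : v <> 0%N.
  move=> v0; move: v2; rewrite v0 dvd0n muln_eq0 => /orP[]/eqP e0.
    by have := sm 0%N; rewrite e0 dvdn0 => /(_ isT).
  by have := sn 0%N; rewrite e0 dvdn0 => /(_ isT).
have pp : prime (pdiv v) by apply: pdiv_prime; lia.
have p2 : (pdiv v ^ 2 %| m * n)%N.
  by apply: dvdn_trans v2; rewrite dvdn_exp2r // pdiv_dvd.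
have pmn : (pdiv v %| m * n)%N by apply: dvdn_trans p2; rewrite expnS dvdn_mulr.
have p1 := prime_gt1 pp.
move: pmn; rewrite Euclid_dvdM // => /orP[pm|pn].
- have : coprime (pdiv v ^ 2) n by rewrite coprimeXl // (coprime_dvdl pm).
  by move=> c2; move: p2; rewrite Gauss_dvdl // => /sm p1'; rewrite p1' in p1.
- have : coprime (pdiv v ^ 2) m.
    by rewrite coprimeXl // coprime_sym (coprime_dvdr pn).
  by move=> c2; move: p2; rewrite Gauss_dvdr // => /sn p1'; rewrite p1' in p1.
Qed.

(** Take [f] maximal with [f ^ 2] dividing [n]: a square [v ^ 2] dividing the cofactor would allow
    [v * f] as well. *)
Lemma squarefree_part n : (0 < n)%N ->
  exists d f, squarefree d /\ n = (d * f ^ 2)%N.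
Proof.
move=> n0; have ex : exists f, (f ^ 2 %| n)%N by exists 1%N; rewrite dvd1n.
have bd f : (f ^ 2 %| n)%N -> (f <= n)%N.
  by move=> /(dvdn_leq n0); nia.
case: (ex_maxnP ex bd) => f /dvdnP[d nE] fmax; exists d, f; split=> // v.
move=> /dvdnP[e dE]; have := fmax (v * f)%N; rewrite nE dE -mulnA -expnMn.
rewrite dvdn_mull // => /(_ isT); nia.
Qed.

(** In lowest terms the squared denominator is prime to the squared numerator, so it divides [n]. *)
Lemma squarefree_rat_int (n : nat) (q : rat) : squarefree n ->
  n%:R * q ^+ 2 \is a Num.int -> q \is a Num.int.
Proof.
move=> sn /intrP[k kE]; rewrite Qint_def.
have d0 : (denq q)%:~R != 0 :> rat by rewrite intr_eq0 denq_neq0.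
have e : n%:Z * numq q ^+ 2 = k * denq q ^+ 2.
  apply: (@intr_inj rat); rewrite [LHS]rmorphM [RHS]rmorphM /=.
  by rewrite 2!rmorphXn /= -kE numqE exprMn mulrA pmulrn.
have := congr1 absz e; rewrite [LHS]abszM [RHS]abszM 2!abszX absz_nat => en.
have c : coprime (`|denq q| ^ 2) (`|numq q| ^ 2).
  by rewrite coprimeXl // coprimeXr // coprime_sym coprime_num_den.
have : (`|denq q| ^ 2 %| n * `|numq q| ^ 2)%N by rewrite en dvdn_mull.
rewrite Gauss_dvdl // => /sn dq1.
by rewrite -absz_denq dq1.
Qed.

Lemma squarefree_rat_sqr (n : nat) (q : rat) : squarefree n ->
  n%:R * q ^+ 2 = 1 -> n = 1%N.
Proof.
move=> sn e; have /intrP[k kE] : q \is a Num.int.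
  by apply: (squarefree_rat_int sn); rewrite e.
move: e; rewrite kE => e.
have : n%:Z * k ^+ 2 = 1.
  by apply: (@intr_inj rat); rewrite rmorphM rmorphXn /= -pmulrn.
by move=> /(congr1 absz)/eqP; rewrite abszM absz_nat muln_eq1 => /andP[/eqP].
Qed.

(** This is the irrationality of [sqrt n], the source of linear independence and of nonzero norms
    below. *)
Lemma squarefree_not_sqr (n : nat) (a b : rat) : squarefree n -> n != 1%N ->
  a ^+ 2 = n%:R * b ^+ 2 -> b = 0.
Proof.
move=> sn n1 e; apply/eqP/negPn/negP => b0; move/eqP: n1; apply.
have [a0|a0] := eqVneq a 0.
  move: e; rewrite a0 expr0n /= => /esym/eqP; rewrite mulf_eq0 expf_eq0 /=.
  rewrite (negPf b0) orbF pnatr_eq0 => /eqP n0.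
  by rewrite n0 in sn; have := sn 0%N (dvdn0 _).
apply: (@squarefree_rat_sqr n (b / a)) => //.
by rewrite expr_div_n mulrA -e divff // expf_neq0.
Qed.

(** Euclid's argument with [4 n! - 1]: a number that is 3 modulo 4 has a prime factor of the same
    class, since otherwise removing a prime factor leaves a smaller such number. *)
Lemma prime_3mod4_above (n : nat) : exists p, [/\ (n < p)%N, prime p & p %% 4 = 3]%N.
Proof.
have big : (0 < n`!)%N by rewrite fact_gt0.
pose m := (4 * n`! - 1)%N.
have m3 : (m %% 4 = 3)%N by rewrite /m; lia.
have H k : (k %% 4 = 3)%N -> exists p, [/\ prime p, p %| k & p %% 4 = 3]%N.
  elim/ltn_ind: k => k IH k3.
  have pp : prime (pdiv k) by apply: pdiv_prime; lia.
  have /dvdnP[j kE] := pdiv_dvd k; have p1 := prime_gt1 pp.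
  have [p3|p3] := eqVneq (pdiv k %% 4)%N 3%N.
    by exists (pdiv k); rewrite pdiv_dvd.
  have j3 : (j %% 4 = 3)%N.
    have : ((pdiv k %% 4) * (j %% 4) %% 4 = 3)%N by rewrite modnMm mulnC -kE.
    have : (pdiv k %% 4 < 4)%N by rewrite ltn_mod.
    have : (j %% 4 < 4)%N by rewrite ltn_mod.
    move: p3; move: (pdiv k %% 4)%N (j %% 4)%N.
    by case=> [|[|[|[|a]]]] [|[|[|[|b]]]].
  have [|p [? pj ?]] := IH j _ j3; first nia.
  by exists p; split=> //; rewrite kE dvdn_mulr.
have [p [pp pm p3]] := H m m3; exists p; split=> //.
rewrite ltnNge; apply/negP => pn.
have : (p %| 4 * n`!)%N by rewrite dvdn_mull // dvdn_fact // prime_gt0.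
rewrite (_ : 4 * n`! = m + 1)%N; last by rewrite /m; lia.
by rewrite dvdn_addr // dvdn1 => /eqP p1; rewrite p1 in pp.
Qed.

(* With [L = 3p], [(8L+1)^2 - 1 = 16 L (4L+1)] gives a solution of the Pell
   equation for the squarefree part of [L (4L+1)]. *)
Lemma pell_parameters (N : nat) : exists x y n f : nat,
  [/\ [/\ N < x, 1 < y, x %% 4 = 1 & y %% 4 = 1],
      squarefree (x * y), 0 < f & n ^ 2 = (x * y) * f ^ 2 + 1]%N.
Proof.
(* The factor 3 turns a prime that is 3 modulo 4 into an [L = 3p] that is 1 modulo 4; [p > 3] keeps
   [L] squarefree. *)
have [p [pN pp p3]] := prime_3mod4_above (N + 3).
have c3 : coprime 3 p.
  rewrite prime_coprime //; apply/negP => /(primeP pp).2.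
  by case/orP=> /eqP; lia.
have sL : squarefree (3 * p) by apply: squarefree_mul => //; exact: squarefree_prime.
have [|y [f [sy yE]]] := @squarefree_part (4 * (3 * p) + 1); first by lia.
have cL : coprime (3 * p) y.
  have : coprime (3 * p) (y * f ^ 2).
    by rewrite -yE /coprime gcdnMDl gcdn1.
  by rewrite coprimeMr => /andP[].
have p1 : (3 * p %% 4 = 1)%N by lia.
have f1 : (f ^ 2 %% 4 = 1)%N.
  have : odd (y * f ^ 2) by rewrite -yE oddD !oddM.
  rewrite oddM oddX /= => /andP[_ fodd].
  have fo : (f %% 2 = 1)%N by rewrite modn2 fodd.
  rewrite (divn_eq f 2) fo; nia.
have y1 : (y %% 4 = 1)%N.
  have : ((y %% 4) * (f ^ 2 %% 4) %% 4 = 1)%N by rewrite modnMm -yE; lia.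
  by rewrite f1 muln1 modn_mod.
exists (3 * p)%N, y, (8 * (3 * p) + 1)%N, (4 * f)%N.
have key : ((8 * (3 * p) + 1) ^ 2 = 3 * p * y * (4 * f) ^ 2 + 1)%N.
  have -> : (3 * p * y * (4 * f) ^ 2 = 16 * (3 * p) * (y * f ^ 2))%N by nia.
  by rewrite -yE; nia.
have f0 : (0 < f)%N by case: f {yE key} f1.
split=> //; [|exact: squarefree_mul|by rewrite muln_gt0].
split=> //; first by lia.
(* If [y = 1], then [4L + 1] is an odd square [(2t + 1)^2], so [L = t (t + 1)] is even, whereas [3p]
   is odd. *)
rewrite ltnNge; apply/negP => yle.
have yy : y = 1%N by lia.
rewrite yy mul1n in yE.
have fo : (f %% 2 = 1)%N.
  have : odd (f ^ 2) by rewrite -yE oddD !oddM.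
  by rewrite oddX /= modn2 => ->.
have := divn_eq f 2; rewrite fo; set t := (f %/ 2)%N => ft.
clearbody t.
have : (3 * p = t * (t + 1))%N by move: yE; rewrite ft -mulnn; nia.
have : odd (3 * p) by lia.
by move=> + e; rewrite e oddM oddD; case: odd.
Qed.

(** * Discrete groups, integrality and embeddings *)

(** A group of positive reals that avoids the interval from 1 to [c] is discrete: the infimum of its
    elements above 1 is attained, and repeated division by this minimum shows that it generates. *)
Lemma discrete_group_cyclic (R : realType) (U : set R) (c : R) :
    1 < c -> (forall u, U u -> 0 < u) ->
    (forall u v, U u -> U v -> U (u / v)) ->
    (forall u, U u -> 1 < u -> c <= u) -> (exists2 u, U u & 1 < u) ->
  exists e, [/\ U e, 1 < e & forall u, U u -> exists n : int, u = e ^ n].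
Proof.
move=> c1 U0 Udiv Uc [u0 Uu0 u01].
pose A := [set u | U u /\ 1 < u].
have A0 : A !=set0 by exists u0.
have Alb : has_lbound A by exists c => u [/Uc].
have ic : c <= inf A by apply: lb_le_inf => // u [/Uc].
have [v [Uv v1] vi] : exists2 v, A v & v < inf A * c.
  apply: inf_lt => //; last by rewrite ltr_pMr //; lra.
(* A smaller element of [U] above [1] would be within a ratio [c] of [v]. *)
have vmin u : U u -> 1 < u -> v <= u.
  move=> Uu u1; rewrite leNgt; apply/negP => uv.
  have u0' := U0 _ Uu.
  have iu : inf A <= u by apply: ge_inf.
  have /Uc : 1 < v / u by rewrite ltr_pdivlMr // mul1r.
  move=> /(_ (Udiv _ _ Uv Uu)); rewrite ler_pdivlMr // => cv.
  have : inf A * c <= c * u by rewrite mulrC ler_wpM2l // ltW // (lt_trans ltr01).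
  by move=> /le_trans/(_ cv); rewrite leNgt vi.
have U1 : U 1 by rewrite -(divff (lt0r_neq0 (U0 _ Uv))); apply: Udiv.
have UV u : U u -> U u^-1 by move=> Uu; rewrite -[u^-1]mul1r; apply: Udiv.
have UX n : U (v ^+ n).
  elim: n => [|n IH]; first by rewrite expr0.
  by rewrite exprS -[v ^+ n]invrK; apply: Udiv => //; apply: UV.
have nat_pow u : U u -> 1 <= u -> exists n : nat, u = v ^+ n.
  move=> Uu u1.
  have [n un] : exists n : nat, u < v ^+ n.
    have bern n : 1 + n%:R * (v - 1) <= v ^+ n.
      elim: n => [|n IH]; first by rewrite mul0r addr0 expr0.
      have v0 : 0 < v by lra.
      rewrite exprS; apply: le_trans (_ : v * (1 + n%:R * (v - 1)) <= _).
        by rewrite -natr1; have := mulr_ge0 (ler0n R n) (sqr_ge0 (v - 1)); lra.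
      by rewrite ler_pM2l.
    exists (Num.truncn (u / (v - 1))).+1.
    apply: lt_le_trans (bern _).
    have := truncnS_gt (u / (v - 1)); rewrite ltr_pdivrMr; last by lra.
    by move=> /lt_le_trans; apply; rewrite lerDr.
  elim: n u Uu u1 un => [|n IH] u Uu u1; first by rewrite expr0 ltNge u1.
  rewrite exprS => un; have v0 : 0 < v by lra.
  have [uv|vu] := ltP u v.
    exists 0%N; rewrite expr0; apply/eqP; rewrite eq_le u1 leNgt andbT.
    by apply/negP => /(vmin _ Uu); rewrite leNgt uv.
  have [|||m mE] := IH (u / v); first exact: Udiv.
  - by rewrite ler_pdivlMr // mul1r.
  - by rewrite ltr_pdivrMr // mulrC.
  by exists m.+1; rewrite exprS -mE mulrC divfK // gt_eqF.
exists v; split=> // u Uu; have [u1|u1] := leP 1 u.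
  by have [n ->] := nat_pow u Uu u1; exists n%:Z; rewrite exprnP.
have u0' := U0 _ Uu.
have [||n nE] := nat_pow u^-1; first exact: UV.
  by rewrite -invr1 lef_pV2 ?posrE // ltW.
by exists (- n%:Z); rewrite -invr_expz -exprnP -nE invrK.
Qed.

(** The monic equation descends from [R[i]] to [rat] and is then carried to [algC], where rational
    algebraic integers are integers. *)
Lemma integral_rat (R : realType) (q : rat) :
  integralOver (intr : int -> R[i]) (ratr q) -> q \is a Num.int.
Proof.
move=> [p pm pq]; rewrite -algC.Cint_rat.
have : root (map_poly intr p : {poly rat}) q.
  rewrite -(fmorph_root (@ratr R[i])) -map_poly_comp.
  by rewrite (eq_map_poly (g := intr)) // => k /=; rewrite ratr_int.
rewrite -(fmorph_root (@ratr algC)) -map_poly_comp.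
rewrite (eq_map_poly (g := intr)) => [|k /=]; last by rewrite ratr_int.
move=> rq; apply: algnum.Cint_rat_Aint; first exact: algC.Crat_rat.
apply: algnum.root_monic_Aint rq _ _; first exact: monic_map.
by apply/polyOverP => i; rewrite coef_map /= intr_int.
Qed.

Lemma integral_quadratic (R K : comNzRingType) (RtoK : {rmorphism R -> K})
    (s n : R) (t : K) :
  t ^+ 2 = RtoK s * t + RtoK n -> integralOver RtoK t.
Proof.
move=> e; exists ('X^2 - (s *: 'X + n%:P)).
  rewrite monicE lead_coefDl ?lead_coefXn // size_polyXn size_polyN ltnS.
  rewrite (leq_trans (size_polyD _ _)) // geq_max size_polyC.
  rewrite (leq_trans (size_scale_leq _ _)) ?size_polyX //.
  by case: eqP.
rewrite /root !rmorphB /= rmorphD /= map_polyXn linearZ /= map_polyX map_polyC /=.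
by rewrite !hornerE e subrr.
Qed.

Section Embeddings.
Variables (R : realType) (K : set R[i]).
Hypothesis Ksub : is_subfield K.

Lemma subfield1 : K 1.
Proof. by case: Ksub => + _ _; rewrite inE. Qed.

Lemma subfieldB x y : K x -> K y -> K (x - y).
Proof.
by move=> Kx Ky; case: Ksub => _ /(_ x y) + _; rewrite !inE; apply.
Qed.

Lemma subfield_div x y : K x -> K y -> K (x / y).
Proof.
by move=> Kx Ky; case: Ksub => _ _ /(_ x y); rewrite !inE; apply.
Qed.

Lemma subfield0 : K 0.
Proof. by rewrite -(subrr 1); apply: subfieldB; exact: subfield1. Qed.

Lemma subfieldN x : K x -> K (- x).
Proof. by move=> Kx; rewrite -sub0r; apply: subfieldB => //; exact: subfield0. Qed.

Lemma subfieldD x y : K x -> K y -> K (x + y).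
Proof. by move=> Kx Ky; rewrite -[y]opprK; apply: subfieldB => //; exact: subfieldN. Qed.

Lemma subfieldV x : K x -> K x^-1.
Proof. by move=> Kx; rewrite -[_^-1]mul1r; apply: subfield_div => //; exact: subfield1. Qed.

Lemma subfieldM x y : K x -> K y -> K (x * y).
Proof. by move=> Kx Ky; rewrite -[y]invrK; apply: subfield_div => //; exact: subfieldV. Qed.

Lemma subfield_int (k : int) : K k%:~R.
Proof.
have Kn (n : nat) : K n%:R.
  elim: n => [|n IH]; first exact: subfield0.
  by rewrite -natr1; apply: subfieldD => //; exact: subfield1.
case: k => n; first exact: Kn.
by rewrite NegzE mulrNz; apply: subfieldN; exact: Kn.
Qed.

Lemma subfield_rat (q : rat) : K (ratr q).
Proof. by apply: subfield_div; exact: subfield_int. Qed.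

Variable t : R[i] -> R[i].
Hypothesis tE : embedding K t.

(** The composite of [t] with [ratr] is a ring morphism on [rat], and there is only one. *)
Lemma embedding_rat (q : rat) : t (ratr q) = ratr q.
Proof.
case: tE => t1 tD tM.
have t0 : t 0 = 0.
  have := tD 0 0 subfield0 subfield0; rewrite addr0 => e.
  by apply: (addrI (t 0)); rewrite -e addr0.
have tN x : K x -> t (- x) = - t x.
  move=> Kx; apply/eqP; rewrite -addr_eq0 -tD //; last exact: subfieldN.
  by rewrite addNr t0.
pose f (q : rat) := t (ratr q).
have fB : GRing.zmod_morphism f.
  move=> a b; rewrite /f rmorphB /= tD ?tN //; try exact: subfield_rat.
  by apply: subfieldN; exact: subfield_rat.
have fM : GRing.monoid_morphism f.
  split=> [|a b]; first by rewrite /f rmorph1.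
  by rewrite /f rmorphM /= tM //; exact: subfield_rat.
pose F : {rmorphism rat -> R[i]} := HB.pack f
  (GRing.isZmodMorphism.Build _ _ f fB) (GRing.isMonoidMorphism.Build _ _ f fM).
exact: (fmorph_eq_rat F q).
Qed.

Lemma embedding0 : t 0 = 0.
Proof. by rewrite -(rmorph0 (@ratr R[i])) embedding_rat. Qed.

Lemma embedding_int (k : int) : t k%:~R = k%:~R.
Proof. by rewrite -(ratr_int R[i]) embedding_rat. Qed.

Lemma embedding_integral x : K x ->
  integralOver (intr : int -> R[i]) x -> integralOver (intr : int -> R[i]) (t x).
Proof.
case: tE => t1 tD tM Kx [p pm /rootP px]; exists p => //; apply/rootP.
(* As [t] respects the operations only inside [K], the induction also carries the membership of the
   value in [K]. *)
suff [_ <-] : K (map_poly intr p).[x] /\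
    t (map_poly intr p).[x] = (map_poly intr p).[t x].
  by rewrite px embedding0.
elim/poly_ind: p {pm px} => [|p c [Kp IH]].
  by rewrite rmorph0 !horner0 embedding0; split=> //; exact: subfield0.
rewrite rmorphD rmorphM /= map_polyX map_polyC !hornerE.
split; first by apply: subfieldD; [exact: subfieldM | exact: subfield_int].
rewrite tD ?tM ?IH ?embedding_int //; first exact: subfieldM.
exact: subfield_int.
Qed.

End Embeddings.

(** * The biquadratic field in coordinates *)

Section Coordinates.
Variables (R : realType) (x : nat).

(** Dividing by [x] makes the fourth basis vector a square root of [-yz], so that all three
    irrational basis vectors have squarefree squares up to sign. *)
Definition bq (al be : R[i]) (a b c e : rat) : R[i] :=
  ratr a + ratr b * al + ratr c * be + ratr e * (al * be / x%:R).

Definition bq_field (al be : R[i]) : set R[i] :=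
  [set w | exists a b c e, w = bq al be a b c e].

Variables (y z : nat) (al be : R[i]).
Hypotheses (x0 : (0 < x)%N) (z0 : (0 < z)%N).
Hypotheses (sxy : squarefree (x * y)) (xy1 : (1 < x * y)%N).
Hypotheses (al2 : al ^+ 2 = (x * y)%:R) (be2 : be ^+ 2 = - (x * z)%:R).

Local Notation ga := (al * be / x%:R).

Let xC0 : x%:R != 0 :> R[i].
Proof. by rewrite pnatr_eq0 -lt0n. Qed.

Lemma bq_relations :
  [/\ al * be = x%:R * ga, al * ga = y%:R * be, be * ga = - (z%:R * al) &
      ga ^+ 2 = - (y%:R * z%:R)].
Proof.
have a2 : al * al = x%:R * y%:R by rewrite -expr2 al2 natrM.
have b2 : be * be = - (x%:R * z%:R) by rewrite -expr2 be2 natrM.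
split.
- by field.
- by rewrite !mulrA a2; field.
- by rewrite mulrCA !mulrA -(mulrA al) b2; field.
- transitivity ((al * al) * (be * be) / x%:R ^+ 2); first by field.
  by rewrite a2 b2; field.
Qed.

Lemma bqB a b c e a' b' c' e' :
  bq al be a b c e - bq al be a' b' c' e' =
  bq al be (a - a') (b - b') (c - c') (e - e').
Proof. by rewrite /bq !rmorphB /=; ring. Qed.

Lemma bqD a b c e a' b' c' e' :
  bq al be a b c e + bq al be a' b' c' e' =
  bq al be (a + a') (b + b') (c + c') (e + e').
Proof. by rewrite /bq !rmorphD /=; ring. Qed.

Lemma bqM a b c e a' b' c' e' :
  bq al be a b c e * bq al be a' b' c' e' = bq al be
    (a * a' + x%:R * y%:R * (b * b') - x%:R * z%:R * (c * c')
      - y%:R * z%:R * (e * e'))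
    (a * b' + b * a' - z%:R * (c * e' + e * c'))
    (a * c' + c * a' + y%:R * (b * e' + e * b'))
    (a * e' + e * a' + x%:R * (b * c' + c * b')).
Proof.
rewrite /bq; have [r1 r2 r3 r4] := bq_relations.
move: r1 r2 r3 r4; set g := ga => r1 r2 r3 r4.
rewrite !(rmorphD, rmorphN, rmorphM) /=.
move: (ratr a) (ratr b) (ratr c) (ratr e) => A B C E.
move: (ratr a') (ratr b') (ratr c') (ratr e') => A' B' C' E'.
transitivity (A * A' + B * B' * al ^+ 2 + C * C' * be ^+ 2 + E * E' * g ^+ 2
  + (A * B' + B * A') * al + (A * C' + C * A') * be + (A * E' + E * A') * g
  + (B * C' + C * B') * (al * be) + (B * E' + E * B') * (al * g)
  + (C * E' + E * C') * (be * g)); first by ring.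
by rewrite al2 be2 r1 r2 r3 r4 !natrM !rmorph_nat; ring.
Qed.

Lemma bq_rat a : ratr a = bq al be a 0 0 0.
Proof. by rewrite /bq !rmorph0 !mul0r !addr0. Qed.

Lemma bq1 : bq al be 1 0 0 0 = 1.
Proof. by rewrite -bq_rat rmorph1. Qed.

Lemma al_real : al^* = al.
Proof.
apply: conj_Creal.
have /eqP : al ^+ 2 = sqrtC (x * y)%:R ^+ 2 by rewrite sqrtCK.
have sr : sqrtC (x * y)%:R \is @Num.real R[i] by apply: sqrtC_real.
by rewrite eqf_sqr => /orP[] /eqP ->; rewrite ?rpredN.
Qed.

Lemma be_neq0 : be != 0.
Proof. by rewrite -sqrf_eq0 be2 oppr_eq0 pnatr_eq0 -lt0n muln_gt0 x0. Qed.

Lemma be_imaginary : be^* = - be.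
Proof.
have : (be^*) ^+ 2 == be ^+ 2 by rewrite -rmorphXn /= be2 rmorphN rmorph_nat.
rewrite eqf_sqr => /orP[] /eqP // /CrealP br.
have : 0 <= be ^+ 2 by exact: real_exprn_even_ge0.
by rewrite be2 oppr_ge0 lern0 muln_eq0 !gtn_eqF.
Qed.

Lemma bq_conj a b c e : (bq al be a b c e)^* = bq al be a b (- c) (- e).
Proof.
have cq q : (ratr q : R[i])^* = ratr q by rewrite fmorph_rat.
rewrite /bq !(rmorphN (@ratr R[i])) /=; move: (cq a) (cq b) (cq c) (cq e).
move: (ratr a) (ratr b) (ratr c) (ratr e) => A B C E hA hB hC hE.
rewrite !rmorphD !rmorphM fmorphV rmorph_nat /= hA hB hC hE al_real be_imaginary.
by ring.
Qed.

Lemma quad_eq0 a b : ratr a + ratr b * al = 0 -> a = 0 /\ b = 0.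
Proof.
move=> h; have e : ratr a = - (ratr b * al) by apply/eqP; rewrite -addr_eq0 h.
have b0 : b = 0.
  apply: (squarefree_not_sqr sxy) (_ : a ^+ 2 = _); first by rewrite gtn_eqF.
  apply: (fmorph_inj (@ratr R[i])).
  by rewrite [LHS]rmorphXn [RHS]rmorphM /= rmorphXn /= e sqrrN exprMn al2 ratr_nat mulrC.
split=> //; move: h; rewrite b0 rmorph0 mul0r addr0 => /eqP.
by rewrite fmorph_eq0 => /eqP.
Qed.

(** Complex conjugation fixes [a + b al] and negates the rest, so both parts vanish; the second is
    [be] times an element of [Q(al)]. *)
Lemma bq_eq0 a b c e : bq al be a b c e = 0 -> [/\ a = 0, b = 0, c = 0 & e = 0].
Proof.
move=> w0; have wc0 : bq al be a b (- c) (- e) = 0 by rewrite -bq_conj w0 rmorph0.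
have two : 2 != 0 :> R[i] by rewrite pnatr_eq0.
have [a0 b0] : a = 0 /\ b = 0.
  apply: quad_eq0; apply: (mulfI two); rewrite mulr0.
  by rewrite -[RHS](addr0 0) -{1}w0 -wc0 /bq !rmorphN; ring.
move: w0; rewrite a0 b0 /bq !rmorph0 mul0r !add0r => w0.
have [c0 e0] : c = 0 /\ e / x%:R = 0.
  apply: quad_eq0; apply: (mulIf be_neq0); rewrite mul0r -w0 fmorph_div /= ratr_nat.
  by field.
split=> //; move/eqP: e0; rewrite mulf_eq0 invr_eq0 pnatr_eq0.
by rewrite [(x == 0)%N]gtn_eqF // orbF => /eqP.
Qed.

Lemma bq_inj a b c e a' b' c' e' : bq al be a b c e = bq al be a' b' c' e' ->
  [/\ a = a', b = b', c = c' & e = e'].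
Proof.
move=> /eqP; rewrite -subr_eq0 bqB => /eqP/bq_eq0[] /eqP + /eqP + /eqP + /eqP.
by rewrite !subr_eq0 => /eqP-> /eqP-> /eqP-> /eqP->.
Qed.

(** The inverse is built in two stages: multiplying by the complex conjugate lands in [Q(al)], where
    the norm [p^2 - xy q^2] is nonzero by irrationality. *)
Lemma bqV a b c e : exists a' b' c' e',
  (bq al be a b c e)^-1 = bq al be a' b' c' e'.
Proof.
have [w0|w0] := eqVneq (bq al be a b c e) 0.
  by exists 0, 0, 0, 0; rewrite w0 invr0 /bq !rmorph0; ring.
pose w' := bq al be a b (- c) (- e).
have w'0 : w' != 0 by rewrite /w' -bq_conj conjC_eq0.
have [p [q ww]] : exists p q, bq al be a b c e * w' = bq al be p q 0 0.
  rewrite bqM; do 2!eexists; congr (bq _ _ _ _ _ _); last by ring.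
  by ring.
have : bq al be a b c e * w' != 0 by rewrite mulf_neq0.
rewrite ww => pq0.
pose n := p ^+ 2 - (x * y)%:R * q ^+ 2.
have n0 : n != 0.
  apply: contraNneq pq0 => /eqP; rewrite subr_eq0 => /eqP pq.
  have q0 : q = 0 by apply: (squarefree_not_sqr sxy _ pq); rewrite gtn_eqF.
  move: pq; rewrite q0 expr0n mulr0 => /eqP; rewrite sqrf_eq0 => /eqP ->.
  by rewrite /bq !rmorph0; apply/eqP; ring.
have pqn : bq al be p q 0 0 * bq al be (p / n) (- q / n) 0 0 = 1.
  rewrite bqM; transitivity (bq al be 1 0 0 0); last exact: bq1.
  congr (bq _ _ _ _ _ _); try by ring.
  by rewrite /n natrM in n0 *; field.
have : exists a' b' c' e', w' * bq al be (p / n) (- q / n) 0 0 = bq al be a' b' c' e'.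
  by rewrite bqM; do 4!eexists.
move=> [a' [b' [c' [e' e1]]]]; exists a', b', c', e'; rewrite -e1.
by apply: (mulfI w0); rewrite divff // mulrA ww pqn.
Qed.

Lemma bq_subfield : is_subfield (bq_field al be).
Proof.
split=> [|u v|u v]; rewrite !inE.
- by exists 1, 0, 0, 0; rewrite bq1.
- move=> [a [b [c [e ->]]]] [a' [b' [c' [e' ->]]]].
  by rewrite bqB; do 4!eexists.
- move=> [a [b [c [e ->]]]] [a' [b' [c' [e' ->]]]].
  have [p [q [r [s ->]]]] := bqV a' b' c' e'.
  by rewrite bqM; do 4!eexists.
Qed.

Lemma bq_al : al = bq al be 0 1 0 0.
Proof. by rewrite /bq !rmorph0 rmorph1; ring. Qed.

Lemma bq_be : be = bq al be 0 0 1 0.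
Proof. by rewrite /bq !rmorph0 rmorph1; ring. Qed.

Lemma bq_ga : ga = bq al be 0 0 0 1.
Proof. by rewrite /bq !rmorph0 rmorph1; ring. Qed.

Lemma bq_in a b c e : bq_field al be (bq al be a b c e).
Proof. by exists a, b, c, e. Qed.

Lemma bq_in_al : bq_field al be al.
Proof. by exists 0, 1, 0, 0; exact: bq_al. Qed.

Lemma bq_in_be : bq_field al be be.
Proof. by exists 0, 0, 1, 0; exact: bq_be. Qed.

Lemma bq_field_adjoin2 : bq_field al be = adjoin2 al be.
Proof.
apply/seteqP; split=> [w [a [b [c [e ->]]]] L [Ls Lab]|].
  have La : L al by apply: Lab; left.
  have Lb : L be by apply: Lab; right.
  have Lq q : L (ratr q) by exact: subfield_rat.
  have Lx : L x%:R by rewrite -(ratr_nat R[i] x).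
  do ![apply: subfieldD => //]; do ?[apply: subfieldM => //].
  exact: subfieldV.
apply: smallest_sub; first exact: bq_subfield.
by move=> w [->|->]; [exact: bq_in_al | exact: bq_in_be].
Qed.

Definition bq_basis : 'I_4 -> R[i] := fun i => [:: 1; al; be; ga]`_i.

Lemma bq_is_basis : is_basis ratr (bq_field al be) bq_basis.
Proof.
have sumE (c : {ffun 'I_4 -> rat}) : \sum_(i < 4) ratr (c i) * bq_basis i =
    bq al be (c (inord 0)) (c (inord 1)) (c (inord 2)) (c (inord 3)).
  rewrite !big_ord_recl big_ord0 /bq_basis /= /bq addr0 mulr1 !addrA.
  congr (_ + _ + _ + _); [|congr (_ * _)..];
    by congr (ratr (c _)); apply: val_inj; rewrite /= inordK.
split=> [i|w [a [b [c [e ->]]]]].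
  case: i => [[|[|[|[|i]]]] hi] //; rewrite /bq_basis /=.
  - by exists 1, 0, 0, 0; rewrite bq1.
  - exact: bq_in_al.
  - exact: bq_in_be.
  - by exists 0, 0, 0, 1; exact: bq_ga.
exists [ffun i : 'I_4 => [:: a; b; c; e]`_i]; split.
  by rewrite sumE !ffunE !inordK.
move=> f; rewrite sumE => /bq_inj[-> -> -> ->]; apply/ffunP => i; rewrite ffunE.
by case: i => [[|[|[|[|i]]]] hi] //=; congr (f _); apply: val_inj; rewrite /= inordK.
Qed.

End Coordinates.

(** * Galois conjugates, places, and denominators of integers *)

Section Conjugates.
Variables (R : realType) (x y z : nat) (al be : R[i]).
Hypotheses (x0 : (0 < x)%N) (z0 : (0 < z)%N).
Hypotheses (sxy : squarefree (x * y)) (xy1 : (1 < x * y)%N).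
Hypotheses (al2 : al ^+ 2 = (x * y)%:R) (be2 : be ^+ 2 = - (x * z)%:R).

Local Notation K := (bq_field x al be).
Local Notation elt := (bq x al be).
Local Notation ga := (al * be / x%:R).

Let Ksub : is_subfield K.
Proof. exact: (bq_subfield x0 z0 sxy xy1 al2 be2). Qed.

Let bqI := bq_inj x0 z0 sxy xy1 al2 be2.

Definition bq_coords (w : R[i]) : rat * rat * rat * rat :=
  xget (0, 0, 0, 0) [set q | w = elt q.1.1.1 q.1.1.2 q.1.2 q.2].

(* The conjugation [al |-> (-1)^i al, be |-> (-1)^j be]. *)
Definition bq_map (i j : bool) (w : R[i]) : R[i] :=
  let q := bq_coords w in
  bq x ((-1) ^+ i * al) ((-1) ^+ j * be) q.1.1.1 q.1.1.2 q.1.2 q.2.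

Lemma bq_coordsE a b c e : bq_coords (elt a b c e) = (a, b, c, e).
Proof.
apply: xget_unique => // -[[[a' b'] c'] e'] /= /esym/bqI.
by case=> -> -> -> ->.
Qed.

Lemma bq_flip (i j : bool) a b c e :
  bq x ((-1) ^+ i * al) ((-1) ^+ j * be) a b c e =
  elt a ((-1) ^+ i * b) ((-1) ^+ j * c) ((-1) ^+ (i (+) j) * e).
Proof.
rewrite /bq.
by case: i; case: j; rewrite /= ?(expr0, expr1, mul1r, mulN1r, rmorphN) /=; ring.
Qed.

Lemma bq_mapE i j a b c e : bq_map i j (elt a b c e) =
  elt a ((-1) ^+ i * b) ((-1) ^+ j * c) ((-1) ^+ (i (+) j) * e).
Proof. by rewrite /bq_map bq_coordsE /= bq_flip. Qed.

Lemma sgn_sqr (i : bool) (u : R[i]) : ((-1) ^+ i * u) ^+ 2 = u ^+ 2.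
Proof. by rewrite exprMn sqrr_sign mul1r. Qed.

(** The multiplication table involves [al] and [be] only through their squares, which sign changes
    preserve. *)
Lemma bq_map_embedding i j : embedding K (bq_map i j).
Proof.
split=> [|u v|u v].
- by rewrite -(bq1 x al be) bq_mapE !mulr0.
- move=> [a [b [c [e ->]]]] [a' [b' [c' [e' ->]]]].
  by rewrite bqD /bq_map !bq_coordsE bqD.
- move=> [a [b [c [e ->]]]] [a' [b' [c' [e' ->]]]].
  rewrite (bqM x0 al2 be2) /bq_map !bq_coordsE /=.
  by rewrite (bqM (y := y) (z := z) x0) // sgn_sqr.
Qed.

(** Since [t] fixes the rationals, it sends [al] and [be] to square roots of the same numbers; these
    two signs determine it. *)
Lemma embedding_bq t : embedding K t ->
  exists i j, forall w, K w -> t w = bq_map i j w.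
Proof.
move=> tE; have [t1 tD tM] := tE.
have Kal := bq_in_al x al be; have Kbe := bq_in_be x al be.
have tnat n : t n%:R = n%:R by rewrite pmulrn (embedding_int Ksub tE).
have Kq q : K (ratr q) by exact: subfield_rat.
have sgE (u v : R[i]) : u ^+ 2 = v ^+ 2 -> exists i : bool, u = (-1) ^+ i * v.
  move=> /eqP; rewrite eqf_sqr => /orP[] /eqP ->.
    by exists false; rewrite mul1r.
  by exists true; rewrite mulN1r.
have [i iE] : exists i : bool, t al = (-1) ^+ i * al.
  by apply: sgE; rewrite expr2 -tM // -expr2 al2 tnat.
have [j jE] : exists j : bool, t be = (-1) ^+ j * be.
  apply: sgE; rewrite expr2 -tM // -expr2 be2.
  by have := embedding_int Ksub tE (- (x * z)%:Z); rewrite mulrNz.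
have xC0 : x%:R != 0 :> R[i] by rewrite pnatr_eq0 -lt0n.
have Kga : K ga by exists 0, 0, 0, 1; exact: bq_ga.
have tga : t ga = t al * t be / x%:R.
  have Kx : K x%:R by rewrite -(ratr_nat R[i] x).
  have := tM _ _ Kga Kx; rewrite divfK // tM // tnat => ->.
  by rewrite mulfK.
exists i, j => w [a [b [c [e ->]]]]; rewrite /bq_map bq_coordsE /= /bq.
have KD := subfieldD Ksub; have KM := subfieldM Ksub.
have tq q : t (ratr q) = ratr q by exact: (embedding_rat Ksub tE).
rewrite -iE -jE -tga.
move: (tq a) (tq b) (tq c) (tq e) (Kq a) (Kq b) (Kq c) (Kq e).
move: (ratr a) (ratr b) (ratr c) (ratr e) => A B C E hA hB hC hE KA KB KC KE.
have Kb := KM _ _ KB Kal; have Kc := KM _ _ KC Kbe; have Ke := KM _ _ KE Kga.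
have Kab := KD _ _ KA Kb; have Kabc := KD _ _ Kab Kc.
rewrite (tD _ _ Kabc Ke) (tD _ _ Kab Kc) (tD _ _ KA Kb).
by rewrite (tM _ _ KB Kal) (tM _ _ KC Kbe) (tM _ _ KE Kga) hA hB hC hE.
Qed.

Lemma bq_map_conj i j w : K w -> (bq_map i j w)^* = bq_map i (~~ j) w.
Proof.
move=> [a [b [c [e ->]]]]; rewrite !bq_mapE (bq_conj x0 z0 al2 be2).
by case: i; case: j; rewrite /= ?(expr0, expr1, mul1r, mulN1r, opprK).
Qed.

Lemma bq_map_inj i j i' j' : (forall w, K w -> bq_map i j w = bq_map i' j' w) ->
  i = i' /\ j = j'.
Proof.
move=> h; have := h _ (bq_in_al x al be); have := h _ (bq_in_be x al be).
have eal k l := bq_mapE k l 0 1 0 0; have ebe k l := bq_mapE k l 0 0 1 0.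
rewrite -(bq_al x al be) in eal; rewrite -(bq_be x al be) in ebe.
rewrite !eal !ebe !mulr0 !mulr1 => /bqI[_ _ jj _] /bqI[_ ii _ _].
by case: i j i' j' {h} ii jj => [] [] [] [] // /eqP + /eqP.
Qed.

(** The two binary digits of the index are the signs on [al] and [be]. *)
Lemma bq_embeddings : embeddings K (fun i : 'I_4 => bq_map (odd i) (1 < i)%N).
Proof.
split=> [i|t /embedding_bq[i [j tE]]]; first exact: bq_map_embedding.
have k4 : (i + j.*2 < 4)%N by case: i j {tE} => [] [].
exists (Ordinal k4); split=> [w Kw|k kE] /=.
  by rewrite tE //; case: i j {k4 tE} => [] [].
have [oi jk] : i = odd k /\ j = (1 < k)%N.
  by apply: bq_map_inj => w Kw; rewrite -tE // kE.
apply: val_inj; rewrite /= oi jk.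
by case: k {kE oi jk} => [[|[|[|[|k]]]]].
Qed.

(** Complex conjugation flips the sign on [be], so every place has exactly one representative that
    fixes [be]. *)
Lemma bq_places : arch_places K (fun i : 'I_2 => bq_map (odd i) false).
Proof.
split=> [i|t /embedding_bq[i [j tE]]]; first exact: bq_map_embedding.
have i2 : (i < 2)%N by case: i {tE}.
exists (Ordinal i2); split=> [|k kE] /=.
  case: j tE => tE; [right|left] => w Kw; rewrite tE //; case: i tE i2 => // _ _;
    by rewrite bq_map_conj.
have ik : i = odd k.
  case: kE => kE.
    suff [] : i = odd k /\ j = false by [].
    by apply: bq_map_inj => w Kw; rewrite -tE // kE.
  suff [] : i = odd k /\ j = true by [].
  by apply: bq_map_inj => w Kw; rewrite -tE // kE // bq_map_conj.
by apply: val_inj; rewrite /= ik; case: k {kE ik} => [[|[|k]]].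
Qed.

Local Notation int_elt w := (integralOver (intr : int -> R[i]) w).

Lemma integral_flip (i j : bool) a b c e : int_elt (elt a b c e) ->
  int_elt (elt a ((-1) ^+ i * b) ((-1) ^+ j * c) ((-1) ^+ (i (+) j) * e)).
Proof.
rewrite -bq_mapE; apply: (embedding_integral Ksub); last exact: bq_in.
exact: bq_map_embedding.
Qed.

Lemma integral_ratl a : int_elt (elt a 0 0 0) -> a \is a Num.int.
Proof. by rewrite -bq_rat => /integral_rat. Qed.

(** Here [k] is the norm of [a + b sqrt(m)] in the first alternative and of [a + b sqrt(-m)] in the
    second. *)
Lemma squarefree_half_int (m : nat) (a b k : rat) : squarefree m ->
  2 * a \is a Num.int -> k \is a Num.int ->
  m%:R * b ^+ 2 = a ^+ 2 - k \/ m%:R * b ^+ 2 = k - a ^+ 2 ->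
  2 * b \is a Num.int.
Proof.
move=> sm a2 ki e; apply: (squarefree_rat_int sm).
have -> : m%:R * (2 * b) ^+ 2 = 4 * (m%:R * b ^+ 2) by ring.
case: e => ->.
  have -> : 4 * (a ^+ 2 - k) = (2 * a) ^+ 2 - 4 * k by ring.
  by apply: rpredB; [exact: rpredX | apply: rpredM; rewrite ?rpred_nat].
have -> : 4 * (k - a ^+ 2) = 4 * k - (2 * a) ^+ 2 by ring.
by apply: rpredB; [apply: rpredM; rewrite ?rpred_nat | exact: rpredX].
Qed.

(** The trace [2a] and the norm are integral and rational, hence integers. The same argument serves
    the other two quadratic subfields. *)
Lemma integral_quad_al a b : int_elt (elt a b 0 0) ->
  2 * a \is a Num.int /\ 2 * b \is a Num.int.
Proof.
move=> h; have := integral_flip true false h.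
rewrite !mulr0 expr1 mulN1r => h'.
have a2 : 2 * a \is a Num.int.
  apply: integral_ratl; have := integral_add h h'; rewrite bqD.
  by rewrite !addr0 subrr -mulr2n mulr_natl.
split=> //; have := integral_mul h h'; rewrite (bqM x0 al2 be2).
rewrite !(mul0r, mulr0, addr0, subr0) (_ : a * - b + b * a = 0); last by ring.
move=> /integral_ratl ki.
by apply: (squarefree_half_int sxy a2 ki); left; rewrite natrM; ring.
Qed.

Hypotheses (sxz : squarefree (x * z)) (syz : squarefree (y * z)).

Lemma integral_quad_be a c : int_elt (elt a 0 c 0) ->
  2 * a \is a Num.int /\ 2 * c \is a Num.int.
Proof.
move=> h; have := integral_flip false true h.
rewrite !mulr0 expr1 mulN1r => h'.
have a2 : 2 * a \is a Num.int.
  apply: integral_ratl; have := integral_add h h'; rewrite bqD.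
  by rewrite !addr0 subrr -mulr2n mulr_natl.
split=> //; have := integral_mul h h'; rewrite (bqM x0 al2 be2).
rewrite !(mul0r, mulr0, addr0, subr0) (_ : a * - c + c * a = 0); last by ring.
move=> /integral_ratl ki.
by apply: (squarefree_half_int sxz a2 ki); right; rewrite natrM; ring.
Qed.

Lemma integral_quad_ga a e : int_elt (elt a 0 0 e) ->
  2 * a \is a Num.int /\ 2 * e \is a Num.int.
Proof.
move=> h; have := integral_flip true false h.
rewrite !mulr0 /= expr1 mulN1r => h'.
have a2 : 2 * a \is a Num.int.
  apply: integral_ratl; have := integral_add h h'; rewrite bqD.
  by rewrite !addr0 subrr -mulr2n mulr_natl.
split=> //; have := integral_mul h h'; rewrite (bqM x0 al2 be2).
rewrite !(mul0r, mulr0, addr0, subr0) (_ : a * - e + e * a = 0); last by ring.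
move=> /integral_ratl ki.
by apply: (squarefree_half_int syz a2 ki); right; rewrite natrM; ring.
Qed.

(** The trace to a quadratic subfield doubles the coordinates in that subfield and kills the others;
    its result has half-integral coordinates. *)
Lemma integral_coords a b c e : int_elt (elt a b c e) ->
  [/\ 4 * a \is a Num.int, 4 * b \is a Num.int,
      4 * c \is a Num.int & 4 * e \is a Num.int].
Proof.
have four u : 4 * u = 2 * (u + u) :> rat by ring.
move=> h.
have := integral_add h (integral_flip false true h).
have := integral_add h (integral_flip true false h).
have := integral_add h (integral_flip true true h).
rewrite !bqD /= !expr0 !expr1 !mul1r !mulN1r !subrr => /integral_quad_ga[_ e4].
by move=> /integral_quad_be[_ c4] /integral_quad_al[a4 b4]; rewrite !four.
Qed.

End Conjugates.

(** * Comparing two systems of embeddings or places *)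

Section Transversals.
Variables (T : Type) (D : set T) (E : T -> T -> Prop).

(** Both [embeddings] and [arch_places] have this shape: [D] consists of the embeddings of [K], and
    [E] is agreement on [K], up to complex conjugation in the case of places. *)
Definition transversal n (s : 'I_n -> T) :=
  (forall i, D (s i)) /\ forall t, D t -> exists! i, E t (s i).

Hypotheses (E_sym : forall t u, E t u -> E u t)
  (E_trans : forall t u v, E t u -> E u v -> E t v).

Lemma transversal_inj n m (s : 'I_n -> T) (s' : 'I_m -> T) :
  transversal s -> transversal s' ->
  exists2 f : 'I_m -> 'I_n, injective f & forall j, E (s' j) (s (f j)).
Proof.
move=> [Ds sE] [Ds' s'E].
have [f fE] : exists f : 'I_m -> 'I_n, forall j, E (s' j) (s (f j)).
  have h j : exists i, E (s' j) (s i) by have [i []] := sE _ (Ds' j); exists i.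
  by exists (fun j => proj1_sig (cid (h j))) => j; case: cid.
exists f => // j k fjk; have [i [_ iu]] := s'E _ (Ds' j).
have jk : E (s' j) (s' k) by apply: (E_trans (fE j)); rewrite fjk; apply: E_sym; exact: fE.
rewrite -(iu k jk); apply: esym; apply: iu.
by apply: (E_trans jk); exact: E_sym.
Qed.

Lemma transversal_card n m (s : 'I_n -> T) (s' : 'I_m -> T) :
  transversal s -> transversal s' -> n = m.
Proof.
move=> ts ts'; have [f fi _] := transversal_inj ts ts'.
have [g gi _] := transversal_inj ts' ts.
have := leq_card f fi; have := leq_card g gi; rewrite !card_ord => nm mn.
by apply/eqP; rewrite eqn_leq nm.
Qed.

End Transversals.

(** * Units and the regulator *)

Section NormIdentities.
Variables (R : realType) (x y z : nat) (al be : R[i]).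
Hypotheses (x0 : (0 < x)%N) (z0 : (0 < z)%N).
Hypotheses (al2 : al ^+ 2 = (x * y)%:R) (be2 : be ^+ 2 = - (x * z)%:R).

Local Notation normc := (@Normc.normc R).
Local Notation elt := (bq x al be).

Lemma normc_sqr (u : R[i]) : ((normc u ^+ 2)%:C)%C = u * u^*.
Proof. by rewrite -normCK rmorphXn. Qed.

Lemma normc_ge0 (u : R[i]) : 0 <= normc u.
Proof. by case: u => a b; exact: sqrtr_ge0. Qed.

Lemma normc_1 : normc 1 = 1.
Proof. exact: Normc.normc1. Qed.

Definition qform (a b c e : rat) : rat :=
  a ^+ 2 + (x * y)%:R * b ^+ 2 + (x * z)%:R * c ^+ 2 + (y * z)%:R * e ^+ 2.

(** This is the norm from [Q(al)] to [Q] of [u u^*], that is, the norm of [u] from the whole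
    field. *)
Definition qnorm (a b c e : rat) : rat :=
  qform a b c e ^+ 2 - (x * y)%:R * (2 * (a * b + z%:R * c * e)) ^+ 2.

Lemma bq_mul_conj a b c e : elt a b c e * (elt a b c e)^* =
  elt (qform a b c e) (2 * (a * b + z%:R * c * e)) 0 0.
Proof.
rewrite (bq_conj x0 z0 al2 be2) (bqM x0 al2 be2) /qform !natrM.
by congr (bq _ _ _ _ _ _ _); ring.
Qed.

(** The two moduli are those of one element at the two archimedean places; the sum and the product
    of their squares are the trace and the norm of [u u^*] from [Q(al)]. *)
Lemma normc_bq_sum a b c e :
  normc (elt a b c e) ^+ 2 + normc (elt a (- b) c (- e)) ^+ 2 =
  ratr (2 * qform a b c e).
Proof.
apply: (@complexI R); rewrite rmorphD /= !normc_sqr !bq_mul_conj bqD fmorph_rat.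
by rewrite (bq_rat x al be) /qform; congr (bq _ _ _ _ _ _ _); ring.
Qed.

Lemma normc_bq_prod a b c e :
  normc (elt a b c e) ^+ 2 * normc (elt a (- b) c (- e)) ^+ 2 =
  ratr (qnorm a b c e).
Proof.
apply: (@complexI R); rewrite rmorphM /= !normc_sqr !bq_mul_conj.
rewrite (bqM x0 al2 be2) fmorph_rat (bq_rat x al be) /qnorm /qform !natrM.
by congr (bq _ _ _ _ _ _ _); ring.
Qed.

End NormIdentities.

Section Units.
Variables (R : realType) (x y z : nat) (al be : R[i]).
Hypotheses (x0 : (0 < x)%N) (z0 : (0 < z)%N).
Hypotheses (sxy : squarefree (x * y)) (sxz : squarefree (x * z))
  (syz : squarefree (y * z)).
Hypotheses (xy16 : (16 < x * y)%N) (xz16 : (16 < x * z)%N) (yz16 : (16 < y * z)%N).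
Hypothesis (z4 : (z %% 4 = 3)%N).
Hypotheses (al2 : al ^+ 2 = (x * y)%:R) (be2 : be ^+ 2 = - (x * z)%:R).

Local Notation normc := (@Normc.normc R).
Local Notation K := (bq_field x al be).
Local Notation elt := (bq x al be).
Local Notation int_elt w := (integralOver (intr : int -> R[i]) w).
Local Notation qf := (qform x y z).
Local Notation qn := (qnorm x y z).

Let xy1 : (1 < x * y)%N. Proof. exact: leq_trans xy16. Qed.

Let Ksub : is_subfield K.
Proof. exact: (bq_subfield x0 z0 sxy xy1 al2 be2). Qed.

Let flip := integral_flip x0 z0 sxy xy1 al2 be2.

(** It is the product of the four conjugates, all integral, and it is rational. *)
Lemma int_qnorm a b c e : int_elt (elt a b c e) -> qn a b c e \is a Num.int.
Proof.
move=> h.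
have h1 := flip false true h; have h2 := flip true false h.
have h3 := flip true true h.
have := integral_mul (integral_mul h h1) (integral_mul h2 h3).
rewrite /= !expr0 !expr1 !mul1r !mulN1r.
rewrite -[elt a b (- c) _](bq_conj x0 z0 al2 be2) (bq_mul_conj x0 z0 al2 be2).
have := bq_mul_conj x0 z0 al2 be2 a (- b) c (- e).
rewrite (bq_conj x0 z0 al2 be2) opprK => ->.
rewrite (bqM x0 al2 be2); set n := (n in elt n) => hn.
have -> : qn a b c e = n by rewrite /n /qnorm /qform !natrM; ring.
apply: (@integral_ratl _ x al be); rewrite -[0]/(0 : rat).
rewrite [X in elt _ X](_ : _ = 0) in hn; last by rewrite /qform; ring.
by rewrite !(mulr0, mul0r, addr0) in hn.
Qed.

Lemma int_rat_unit (n n' : rat) : n \is a Num.int -> n' \is a Num.int ->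
  n * n' = 1 -> 0 <= n -> n = 1.
Proof.
move=> /intrP[k ->] /intrP[k' ->]; rewrite -intrM => /eqP.
rewrite -[1]/(1%:~R) eqr_int ler0z => /eqP kk k0.
move/(congr1 absz)/eqP: kk; rewrite abszM muln_eq1 => /andP[/eqP k1 _].
by rewrite -(gez0_abs k0) k1.
Qed.

(** The norms of a unit and of its inverse are integers with product 1; being a product of squared
    moduli, the norm cannot be -1. *)
Lemma unit_qnorm a b c e : units_of K (elt a b c e) -> qn a b c e = 1.
Proof.
case=> [[_ iu] u0 [Kv iv]]; move: Kv iv => [a' [b' [c' [e' vE]]]]; rewrite vE => iv.
apply: (int_rat_unit (int_qnorm iu) (int_qnorm iv)).
  apply: (fmorph_inj (@ratr R)); rewrite rmorphM /= rmorph1.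
  rewrite -!(normc_bq_prod x0 z0 al2 be2).
  have uv : elt a b c e * elt a' b' c' e' = 1 by rewrite -vE divff.
  have tuv : elt a (- b) c (- e) * elt a' (- b') c' (- e') = 1.
    have [m1 _ mM] := bq_map_embedding x0 z0 sxy xy1 al2 be2 true false.
    have := mM _ _ (bq_in x al be a b c e) (bq_in x al be a' b' c' e').
    by rewrite uv m1 !(bq_mapE x0 z0 sxy xy1 al2 be2) expr0 expr1 !mul1r !mulN1r.
  rewrite mulrACA -!exprMn -!Normc.normcM.
  by rewrite uv tuv mulr1 normc_1 expr1n.
rewrite -(ler0q R) -(normc_bq_prod x0 z0 al2 be2).
by rewrite mulr_ge0 // sqr_ge0.
Qed.

(** Norm 1 makes the moduli at the two places inverse to each other. *)
Lemma unit_qform a b c e : units_of K (elt a b c e) ->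
  normc (elt a b c e) ^+ 2 + (normc (elt a b c e) ^+ 2)^-1 =
  ratr (2 * qf a b c e).
Proof.
move=> uu; rewrite -(normc_bq_sum x0 z0 al2 be2); congr (_ + _).
have := normc_bq_prod x0 z0 al2 be2 a b c e; rewrite unit_qnorm // rmorph1.
exact: mulr1_eq.
Qed.

Lemma quarter_int_bound (m : nat) (b : rat) : 4 * b \is a Num.int -> b != 0 ->
  m%:R / 16 <= m%:R * b ^+ 2.
Proof.
move=> /intrP[k kE] b0; apply: ler_wpM2l => //.
have k0 : k != 0.
  by apply: contraNneq b0 => k0; move: kE; rewrite k0 => /eqP; rewrite mulf_eq0.
have k1 : 1 <= k%:~R ^+ 2 :> rat by rewrite -rmorphXn /= ler1z; nia.
have -> : b = k%:~R / 4 by rewrite -kE mulrC mulKf.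
by rewrite expr_div_n; lra.
Qed.

(** A nonzero [b], [c] or [e] is at least 1/4 in absolute value, so its term alone contributes
    [m / 16]. *)
Lemma qform_cases (m : nat) a b c e : int_elt (elt a b c e) ->
  (m <= x * y)%N -> (m <= x * z)%N -> (m <= y * z)%N ->
  [/\ b = 0, c = 0 & e = 0] \/ m%:R / 16 <= qf a b c e.
Proof.
move=> /(integral_coords x0 z0 sxy xy1 al2 be2 sxz syz)[_ b4 c4 e4].
rewrite -!(ler_nat rat) => mxy mxz myz.
have sq u : 0 <= u ^+ 2 :> rat by exact: sqr_ge0.
have sqm (k : nat) u : 0 <= k%:R * u ^+ 2 :> rat by rewrite mulr_ge0.
have := sqm (x * y)%N b; have := sqm (x * z)%N c; have := sqm (y * z)%N e.
have := sq a; rewrite /qform => ? ? ? ?.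
have [b0|b0] := eqVneq b 0; last first.
  by right; have := quarter_int_bound (x * y) b4 b0; lra.
have [c0|c0] := eqVneq c 0; last first.
  by right; have := quarter_int_bound (x * z) c4 c0; lra.
have [e0|e0] := eqVneq e 0; last first.
  by right; have := quarter_int_bound (y * z) e4 e0; lra.
by left.
Qed.

Lemma unit_normc1 u : units_of K u -> normc u = 1 -> u = 1 \/ u = -1.
Proof.
move=> uu nu; have [[[a [b [c [e uE]]]] iu] _ _] := uu.
rewrite uE in uu nu iu *.
have := unit_qform uu; rewrite nu expr1n invr1 => e2.
have q1 : qf a b c e = 1.
  apply: (fmorph_inj (@ratr R)); rewrite rmorph1.
  by move: e2; rewrite rmorphM /= ratr_nat; lra.
(* Here [m = 17]: an irrational coordinate would push the form to 17/16, above its value 1. *)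
have [[b0 c0 e0]|] := qform_cases iu xy16 xz16 yz16; last first.
  have lt1 : 1 < 17%:R / 16 :> rat by lra.
  by rewrite q1 leNgt lt1.
move: q1; rewrite /qform b0 c0 e0 !expr0n /= !mulr0 !addr0 => /eqP.
rewrite sqrf_eq1 => /orP[] /eqP ->; rewrite -bq_rat; [left|right].
  by rewrite rmorph1.
by rewrite rmorphN rmorph1.
Qed.

(** For [s = |u|^2 > 1], the sum [s + 1/s] is at least [m / 8] while [1/s < 1]. The case [m = 17]
    gives discreteness, a large [m] a large regulator. *)
Lemma unit_gap (m : nat) u : (m <= x * y)%N -> (m <= x * z)%N -> (m <= y * z)%N ->
  units_of K u -> 1 < normc u -> m%:R / 8 - 1 <= normc u ^+ 2.
Proof.
move=> mxy mxz myz uu nu; have [[[a [b [c [e uE]]]] iu] _ _] := uu.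
rewrite uE in uu nu iu *.
have s1 : 1 < normc (elt a b c e) ^+ 2 by rewrite exprn_egt1.
have si : (normc (elt a b c e) ^+ 2)^-1 < 1 by rewrite invf_lt1 //; lra.
have := unit_qform uu; move: s1 si; set s := normc _ ^+ 2 => s1 si e2.
have [[b0 c0 e0]|mq] := qform_cases iu mxy mxz myz.
  (* A rational unit has form value 1, whence [s + 1/s = 2] and [s = 1], against [1 < s]. *)
  have := unit_qnorm uu; rewrite /qnorm /qform b0 c0 e0 => n1.
  have q1 : qf a b c e = 1.
    have : (qf a b c e) ^+ 2 = 1.
      by rewrite /qform b0 c0 e0 -[RHS]n1; ring.
    move=> /eqP; rewrite sqrf_eq1 => /orP[] /eqP //.
    by rewrite /qform b0 c0 e0; have := sqr_ge0 a; lra.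
  move: e2; rewrite q1 mulr1 ratr_nat => e2.
  have s0 : s != 0 by rewrite gt_eqF // (lt_trans ltr01).
  have : (s - 1) ^+ 2 = s * (s + s^-1 - 2) by field.
  rewrite e2 subrr mulr0 => /eqP; rewrite sqrf_eq0 subr_eq0 => /eqP s1'.
  by rewrite s1' ltxx in s1.
have : ratr (m%:R / 16) <= ratr (qf a b c e) :> R by rewrite ler_rat.
move: e2; rewrite rmorphM /= !ratr_nat fmorph_div /= !ratr_nat; lra.
Qed.

Lemma units_div u v : units_of K u -> units_of K v -> units_of K (u / v).
Proof.
move=> [[Ku iu] u0 [Ku' iu']] [[Kv iv] v0 [Kv' iv']]; split.
- by split; [exact: subfield_div | exact: integral_mul].
- by rewrite mulf_neq0 // invr_eq0.
- rewrite invfM invrK; split; first exact: subfieldM.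
  exact: integral_mul.
Qed.

Lemma units1 : units_of K 1.
Proof.
have i1 : int_elt 1 by exact: integral1.
by split; rewrite ?oner_neq0 ?invr1 //; split=> //; exact: subfield1.
Qed.

Lemma integers_conj u : integers_of K u -> integers_of K u^*.
Proof.
move=> [[a [b [c [e ->]]]] iu]; rewrite (bq_conj x0 z0 al2 be2).
split; first exact: bq_in.
by have := flip false true iu; rewrite expr0 expr1 /= !mulN1r mul1r.
Qed.

Lemma normc_conj (u : R[i]) : normc u^* = normc u.
Proof. by apply: (@complexI R); exact: (norm_conjC u). Qed.

Lemma normc_eq0 (u : R[i]) : (normc u == 0) = (u == 0).
Proof.
apply/eqP/eqP => [/Normc.eq0_normc //|->]; exact: Normc.normc0.
Qed.

Lemma unit_real u : units_of K u -> u^* = u.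
Proof.
move=> uu; have [iu u0 iu'] := uu.
have uc : units_of K u^*.
  split; [exact: integers_conj | by rewrite conjC_eq0 |].
  by rewrite -fmorphV; exact: integers_conj.
have nu : normc (u^* / u) = 1.
  by rewrite Normc.normcM Normc.normcV normc_conj divff // normc_eq0.
have [|/(canRL (divfK u0))] := unit_normc1 (units_div uc uu) nu.
  by move=> /(canRL (divfK u0)); rewrite mul1r.
(* Now [u^* = -u], so [a = b = 0] and the norm becomes the square of [z (x c^2 - y e^2)]. As [4c]
   and [4e] are integers, [z] divides 16, which is impossible for [z] congruent to 3 modulo 4. *)
rewrite mulN1r; move: iu uu => [[a [b [c [e ->]]]] iu] uu uN; exfalso.
have /(bq_eq0 x0 z0 sxy xy1 al2 be2)[a0 b0 _ _] :
    elt (a + a) (b + b) (c - c) (e - e) = 0.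
  by rewrite -bqD -(bq_conj x0 z0 al2 be2) uN subrr.
have {}a0 : a = 0 by lra.
have {}b0 : b = 0 by lra.
have := unit_qnorm uu; rewrite /qnorm /qform a0 b0 => n1.
have /eqP : (z%:R * (x%:R * c ^+ 2 - y%:R * e ^+ 2)) ^+ 2 = 1.
  by rewrite -[RHS]n1 !natrM; ring.
have [_ _ /intrP[C cE] /intrP[E eE]] := integral_coords x0 z0 sxy xy1 al2 be2 sxz syz iu.
rewrite sqrf_eq1 => zce.
have : z%:Z * (x%:Z * C ^+ 2 - y%:Z * E ^+ 2) = 16 \/
       z%:Z * (x%:Z * C ^+ 2 - y%:Z * E ^+ 2) = - 16.
  have e16 : (z%:Z * (x%:Z * C ^+ 2 - y%:Z * E ^+ 2))%:~R =
      16 * (z%:R * (x%:R * c ^+ 2 - y%:R * e ^+ 2)) :> rat.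
    by rewrite !expr2 intrM rmorphB /= !intrM -cE -eE -!pmulrn; ring.
  by case/orP: zce => /eqP h; [left|right]; apply: (@intr_inj rat); rewrite e16 h.
have z_odd : odd z by lia.
have z1 : (z %| 16)%N -> z = 1%N.
  rewrite -[16%N]/(2 ^ 4)%N => z16.
  have : (z %| 2 ^ 4 * 1)%N by rewrite muln1.
  by rewrite Gauss_dvdr ?coprimeXr ?coprimen2 // dvdn1 => /eqP.
case=> /(congr1 absz); rewrite abszM absz_nat => z16;
  have /z1 z1' : (z %| 16)%N by [rewrite -[16%N]z16 dvdn_mulr];
  by move: z4; rewrite z1'.
Qed.

(** Only [al] enters, not [z] or the splitting of [xy]; this is what allows units to be transported
    between the fields. *)
Definition real_units : set R[i] :=
  [set u | [/\ exists a b, u = ratr a + ratr b * al, int_elt u, u != 0 & int_elt u^-1]].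

Lemma units_of_bq : units_of K = real_units.
Proof.
apply/seteqP; split=> u; last first.
  move=> [[a [b uE]] iu u0 iu'].
  have Ku : K u by exists a, b, 0, 0; rewrite uE /bq !rmorph0 !mul0r !addr0.
  by split=> //; split=> //; exact: subfieldV.
move=> uu; have uc := unit_real uu.
move: uu uc => [[[a [b [c [e uE]]]] iu] u0 [_ iu']]; split=> //.
exists a, b; move: uc; rewrite uE (bq_conj x0 z0 al2 be2).
move=> /(bq_inj x0 z0 sxy xy1 al2 be2)[_ _ c0 e0].
have -> : c = 0 by lra.
have -> : e = 0 by lra.
by rewrite /bq !rmorph0 !mul0r !addr0.
Qed.

Lemma root_of_unity_normc u : roots_of_unity_of K u -> normc u = 1.
Proof.
move=> [_ [m m0 um]]; apply/eqP; rewrite -(pexpr_eq1 m0 (normc_ge0 u)).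
have normcX k : normc (u ^+ k) = normc u ^+ k.
  elim: k => [|k IH]; first by rewrite !expr0 normc_1.
  by rewrite !exprS Normc.normcM IH.
by rewrite -normcX um normc_1.
Qed.

Lemma bq_map_id w : K w -> bq_map x al be false false w = w.
Proof.
move=> [a [b [c [e ->]]]]; rewrite (bq_mapE x0 z0 sxy xy1 al2 be2).
by rewrite /= expr0 !mul1r.
Qed.

(** Up to complex conjugation [t] is the identity or the sign change on [al], and the latter inverts
    the modulus of an element of norm 1. *)
Lemma normc_embedding_unit t u : embedding K t -> units_of K u ->
  normc (t u) = normc u \/ normc (t u) = (normc u)^-1.
Proof.
move=> /(embedding_bq x0 z0 sxy xy1 al2 be2)[i [j tE]] uu.
have [[Ku _] u0 _] := uu; rewrite tE //.
have -> : normc (bq_map x al be i j u) = normc (bq_map x al be i false u).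
  by case: j {tE} => //; rewrite -normc_conj (bq_map_conj x0 z0 sxy xy1 al2 be2).
case: i {tE}; last by rewrite bq_map_id //; left.
right; move: Ku uu u0 => [a [b [c [e ->]]]] uu u0.
rewrite (bq_mapE x0 z0 sxy xy1 al2 be2) /= expr0 expr1 mul1r !mulN1r.
have nu0 : normc (elt a b c e) != 0 by rewrite normc_eq0.
apply: (mulfI nu0); rewrite divff //; apply/eqP.
rewrite -(pexpr_eq1 (n := 2)) ?mulr_ge0 ?normc_ge0 // exprMn.
by rewrite (normc_bq_prod x0 z0 al2 be2) unit_qnorm // rmorph1.
Qed.

Lemma local_degree_bq t : embedding K t -> local_degree K t = 2%N.
Proof.
move=> /(embedding_bq x0 z0 sxy xy1 al2 be2)[i [j tE]].
rewrite /local_degree; case: asboolP => // /(_ _ (bq_in_be x al be)).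
rewrite tE; last exact: bq_in_be.
rewrite [X in bq_map _ _ _ _ _ X](bq_be x al be) (bq_mapE x0 z0 sxy xy1 al2 be2).
move=> /CrealP; rewrite (bq_conj x0 z0 al2 be2).
move=> /(bq_inj x0 z0 sxy xy1 al2 be2)[_ _ + _]; by case: j {tE} => /eqP.
Qed.

Let same_place (t s : R[i] -> R[i]) :=
  (forall w, K w -> t w = s w) \/ (forall w, K w -> t w = (s w)^*).

Lemma arch_places_size r (s : 'I_r.+1 -> R[i] -> R[i]) : arch_places K s -> r = 1%N.
Proof.
move=> sP; suff [] : r.+1 = 2%N by [].
apply: (@transversal_card _ (embedding K) same_place) sP _; last first.
- exact: (bq_places x0 z0 sxy xy1 al2 be2).
- move=> t u v [] tu [] uv; [left|right|right|left] => w Kw; rewrite tu // uv //.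
  by rewrite conjCK.
- move=> t u [] tu; [left|right] => w Kw; rewrite tu //.
  by rewrite conjCK.
Qed.

Lemma unitsV u : units_of K u -> units_of K u^-1.
Proof. by move=> uu; rewrite -[u^-1]mul1r; exact: (units_div units1 uu). Qed.

Lemma units_expz u (n : int) : units_of K u -> units_of K (u ^ n).
Proof.
move=> uu; have u_pow (k : nat) : units_of K (u ^+ k).
  elim: k => [|k IH]; first by rewrite expr0; exact: units1.
  by rewrite exprSr -[u in X in _ * X]invrK; apply: units_div => //; exact: unitsV.
case: n => k; first exact: u_pow.
by rewrite NegzE -invr_expz; apply: unitsV; exact: u_pow.
Qed.

Lemma normcXz (u : R[i]) (n : int) : normc (u ^ n) = normc u ^ n.
Proof.
have normcX k : normc (u ^+ k) = normc u ^+ k.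
  elim: k => [|k IH]; first by rewrite !expr0 normc_1.
  by rewrite !exprS Normc.normcM IH.
case: n => k; first by rewrite -!exprnP normcX.
by rewrite NegzE -!invr_expz Normc.normcV -!exprnP normcX.
Qed.

Lemma root_of_unity_pm1 u : u = 1 \/ u = -1 -> roots_of_unity_of K u.
Proof.
have K1 := subfield1 Ksub; case=> ->.
  by split=> //; exists 1%N.
by split; [exact: subfieldN | exists 2%N; rewrite // sqrrN expr1n].
Qed.

Lemma expz_inj_gt1 (e : R) (m n : int) : 1 < e -> e ^ m = e ^ n -> m = n.
Proof.
move=> e1 /(congr1 (@ln R)); have e0 : 0 < e by exact: lt_trans e1.
have lnz k : ln (e ^ k) = k%:~R * ln e.
  case: k => k; first by rewrite -exprnP lnXn // mulr_natl.
  rewrite NegzE -invr_expz -exprnP lnV ?posrE ?exprn_gt0 // lnXn //.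
  by rewrite mulrNz mulNr mulr_natl.
have ln0 : ln e != 0 by rewrite gt_eqF // ln_gt0.
by rewrite !lnz => /(mulIf ln0)/intr_inj.
Qed.

(** A unit with the modulus of a power of [eps] is that power up to sign, so [eps] is fundamental.
    The factor 2 is the local degree of a complex place. *)
Lemma reg_bq eps : units_of K eps -> 1 < normc eps ->
  (forall u, units_of K u -> exists n : int, normc u = normc eps ^ n) ->
  reg K = 2 * ln (normc eps).
Proof.
move=> ue e1 egen.
have e0 : eps != 0 by case: ue.
have ln0 : 0 < ln (normc eps) by rewrite ln_gt0.
apply: xget_unique.
  exists 1%N, (fun=> eps), (fun i => bq_map x al be (odd i) false); split.
  - split=> [//|u uu]; have [n un] := egen u uu.
    have epsn0 : eps ^ n != 0 by rewrite expfz_neq0.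
    exists (u / eps ^ n, [ffun=> n]); split=> /=.
      rewrite big_ord1 ffunE divfK //; split=> //; apply: root_of_unity_pm1.
      apply: unit_normc1; first by apply: units_div => //; exact: units_expz.
      by rewrite Normc.normcM Normc.normcV normcXz -un divff // normc_eq0; case: uu.
    move=> [zeta c] /= [rz]; rewrite big_ord1 => uE.
    have nc : n = c ord0.
      apply: (expz_inj_gt1 e1); rewrite -un uE Normc.normcM normcXz.
      by rewrite root_of_unity_normc // mul1r.
    congr pair; first by rewrite uE -nc mulfK.
    by apply/ffunP => i; rewrite ffunE ord1.
  - exact: (bq_places x0 z0 sxy xy1 al2 be2).
  - rewrite det_mx11 mxE local_degree_bq /=; last first.
      exact: (bq_map_embedding x0 z0 sxy xy1 al2 be2 _ _).
    by rewrite bq_map_id ?ger0_norm ?mulr_ge0 //; [exact: ltW | case: ue => -[]].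
(* For an arbitrary admissible choice there is one unit; its modulus and that of [eps] are powers of
   each other, so the exponent is 1 or -1. The absolute value absorbs this sign and the choice of
   place. *)
move=> v [r [u [s [[uu ugen] sP ->]]]].
have r1 := arch_places_size sP; subst r.
rewrite det_mx11 mxE local_degree_bq; last exact: sP.1.
have [[Ku _] u0 _] := uu ord0.
have [n un] := egen _ (uu ord0).
have [[zeta c] [[rz ce] _]] := ugen _ ue.
rewrite /= big_ord1 in ce.
have nc : n * c ord0 = 1.
  apply: (expz_inj_gt1 e1); rewrite -exprz_exp -un -normcXz expr1z [in RHS]ce.
  by rewrite Normc.normcM (root_of_unity_normc rz) mul1r.
rewrite normrM ger0_norm //; congr (_ * _).
have -> : `|ln (normc (s (lift ord_max 0) (u 0)))| = `|ln (normc (u ord0))|.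
  have [->|->] := normc_embedding_unit (sP.1 (lift ord_max 0)) (uu ord0); first by [].
  by rewrite lnV ?normrN // posrE lt_neqAle eq_sym normc_eq0 u0 normc_ge0.
have : n = 1 \/ n = -1.
  move/(congr1 absz)/eqP: nc; rewrite abszM muln_eq1 => /andP[/eqP n1 _].
  by case: n n1 {un} => [k|k] /= ; [left|right]; rewrite ?NegzE; congr (_ %:Z) || lia.
rewrite un; case=> ->; first by rewrite expr1z ger0_norm // ltW.
by rewrite exprN1 lnV ?normrN ?ger0_norm ?ltW // posrE (lt_trans ltr01).
Qed.

End Units.

(** * The discriminant *)

Lemma det4 (F : comNzRingType) (m : nat -> nat -> F) :
  \det (\matrix_(i < 4, j < 4) m i j) =
    m 0 0 * (m 1 1 * (m 2 2 * m 3 3 - m 2 3 * m 3 2)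
           - m 1 2 * (m 2 1 * m 3 3 - m 2 3 * m 3 1)
           + m 1 3 * (m 2 1 * m 3 2 - m 2 2 * m 3 1))
  - m 0 1 * (m 1 0 * (m 2 2 * m 3 3 - m 2 3 * m 3 2)
           - m 1 2 * (m 2 0 * m 3 3 - m 2 3 * m 3 0)
           + m 1 3 * (m 2 0 * m 3 2 - m 2 2 * m 3 0))
  + m 0 2 * (m 1 0 * (m 2 1 * m 3 3 - m 2 3 * m 3 1)
           - m 1 1 * (m 2 0 * m 3 3 - m 2 3 * m 3 0)
           + m 1 3 * (m 2 0 * m 3 1 - m 2 1 * m 3 0))
  - m 0 3 * (m 1 0 * (m 2 1 * m 3 2 - m 2 2 * m 3 1)
           - m 1 1 * (m 2 0 * m 3 2 - m 2 2 * m 3 0)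
           + m 1 2 * (m 2 0 * m 3 1 - m 2 1 * m 3 0)).
Proof.
rewrite (expand_det_row _ ord0) !big_ord_recl big_ord0 /cofactor.
rewrite !(expand_det_row _ ord0) !big_ord_recl !big_ord0 /cofactor.
rewrite !(expand_det_row _ ord0) !big_ord_recl !big_ord0 /cofactor.
rewrite !det_mx11 !mxE /= /bump /= !(addn0, add0n, add1n) !exprS !expr0.
by ring.
Qed.

Section Discriminant.
Variables (R : realType).

(** The transition matrices in both directions are integral and inverse to each other, so their
    determinants are 1 or -1. *)
Lemma basis_change (S : set R[i]) n (e f : 'I_n -> R[i]) :
  is_basis (intr : int -> R[i]) S e -> is_basis (intr : int -> R[i]) S f ->
  exists2 P : 'M[int]_n, (\det P) ^+ 2 = 1 &
    forall j, e j = \sum_k (P k j)%:~R * f k.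
Proof.
have coords (e' f' : 'I_n -> R[i]) : is_basis (intr : int -> R[i]) S e' ->
    is_basis (intr : int -> R[i]) S f' ->
    exists P : 'M[int]_n, forall j, e' j = \sum_k (P k j)%:~R * f' k.
  move=> [Se _] [_ fE].
  have h j : exists c : {ffun 'I_n -> int}, e' j = \sum_k (c k)%:~R * f' k.
    by have [c []] := fE _ (Se j); exists c.
  exists (\matrix_(k, j) proj1_sig (cid (h j)) k) => j.
  by rewrite [LHS](proj2_sig (cid (h j))); apply: eq_bigr => k _; rewrite mxE.
move=> be bf; have [P PE] := coords e f be bf; have [Q QE] := coords f e bf be.
exists P => //.
have QP : Q *m P = 1%:M.
  apply/matrixP => k j; have [Se eE] := be.
  have [c [_ cu]] := eE _ (Se j).
  (* The vector [e j] expands in its own basis trivially and also by way of [f]; uniqueness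
     identifies the two expansions. *)
  have c1 : c = [ffun k => (k == j)%:R].
    apply: cu; rewrite (bigD1 j) //= big1 => [|i /negPf ij]; rewrite ffunE.
      by rewrite eqxx mul1r addr0.
    by rewrite ij mul0r.
  have c2 : c = [ffun k => (Q *m P) k j].
    apply: cu; rewrite {1}PE.
    under eq_bigr => i _ do rewrite QE mulr_sumr.
    rewrite exchange_big /=; apply: eq_bigr => i _; rewrite ffunE mxE.
    rewrite rmorph_sum mulr_suml; apply: eq_bigr => l _.
    by rewrite rmorphM /= mulrA; congr (_ * _); rewrite mulrC.
  have := congr1 (fun g : {ffun _} => g k) (etrans (esym c1) c2).
  by rewrite !ffunE => <-; rewrite mxE.
have := congr1 determinant QP; rewrite det_mulmx det1 => PQ.
move/(congr1 absz)/eqP: PQ; rewrite abszM muln_eq1 => /andP[_ /eqP p1].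
by apply/eqP; rewrite sqrf_eq1; move: p1; case: (\det P) => [k|k] /=; lia.
Qed.

Lemma embedding_sum (L : set R[i]) t n (c : 'I_n -> int) (v : 'I_n -> R[i]) :
  is_subfield L -> embedding L t -> (forall k, L (v k)) ->
  t (\sum_k (c k)%:~R * v k) = \sum_k (c k)%:~R * t (v k).
Proof.
move=> Ls tE Lv; have [_ tD tM] := tE.
suff [] : L (\sum_k (c k)%:~R * v k) /\
  t (\sum_k (c k)%:~R * v k) = \sum_k (c k)%:~R * t (v k) by [].
apply: (big_ind2 (fun u w => L u /\ t u = w)) => [|u w u' w' [Lu <-] [Lu' <-]|k _].
- by rewrite (embedding0 Ls tE); split=> //; exact: subfield0.
- by rewrite tD //; split=> //; exact: subfieldD.
- have Lc := subfield_int Ls (c k).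
  by rewrite tM // (embedding_int Ls tE); split=> //; exact: subfieldM.
Qed.

Variables (x y z : nat) (al be : R[i]).
Hypotheses (x0 : (0 < x)%N) (z0 : (0 < z)%N).
Hypotheses (sxy : squarefree (x * y)) (sxz : squarefree (x * z))
  (syz : squarefree (y * z)) (xy1 : (1 < x * y)%N).
Hypotheses (x4 : (x %% 4 = 1)%N) (y4 : (y %% 4 = 1)%N) (z4 : (z %% 4 = 3)%N).
Hypotheses (al2 : al ^+ 2 = (x * y)%:R) (be2 : be ^+ 2 = - (x * z)%:R).

Local Notation K := (bq_field x al be).
Local Notation elt := (bq x al be).
Local Notation ga := (al * be / x%:R).
Local Notation int_elt w := (integralOver (intr : int -> R[i]) w).

Let Ksub : is_subfield K.
Proof. exact: (bq_subfield x0 z0 sxy xy1 al2 be2). Qed.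

Let xC0 : x%:R != 0 :> R[i].
Proof. by rewrite pnatr_eq0 -lt0n. Qed.

(** The halves are integral because [xy] and [-xz] are 1 modulo 4. The last vector is the product of
    the two halves, which has coefficient [x / 4] at [ga], minus [t ga], where [x = 1 + 4t]. *)
Definition int_basis (k : nat) : R[i] :=
  [:: elt 1 0 0 0; elt (1 / 2) (1 / 2) 0 0; elt (1 / 2) 0 (1 / 2) 0;
      elt (1 / 4) (1 / 4) (1 / 4) (1 / 4)]`_k.

Lemma det_int_basis :
  (\det (\matrix_(i < 4, j < 4) bq_map x al be (odd i) (1 < i)%N (int_basis j))) ^+ 2
  = ((x * y * z) ^ 2)%:R.
Proof.
rewrite (det4 (fun i j => bq_map x al be (odd i) (1 < i)%N (int_basis j))) /int_basis /=.
rewrite !(bq_mapE x0 z0 sxy xy1 al2 be2) /= !expr0 !expr1 !mul1r !mulN1r.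
have [r1 r2 r3 r4] := bq_relations x0 al2 be2.
rewrite /bq; move: r1 r2 r3 r4; set g := ga => r1 r2 r3 r4.
rewrite !(rmorphN, rmorph0, rmorph1, fmorphV) /= !ratr_nat.
set d := (X in X ^+ 2 = _).
(* The 4 by 4 sign matrix has determinant 16 up to sign, which cancels the factor 1/16 of the basis
   coefficients. *)
have -> : d = al * be * g by rewrite /d; field.
rewrite r1 -mulrA -expr2 r4 mulrN sqrrN !natrX !natrM; ring.
Qed.

Lemma integral_int_basis (k : 'I_4) : int_elt (int_basis k).
Proof.
have ial : int_elt (elt (1 / 2) (1 / 2) 0 0).
  have [t tE] : exists t : nat, (x * y = 1 + 4 * t)%N.
    by exists ((x * y) %/ 4)%N; rewrite {1}(divn_eq (x * y) 4) -modnMm x4 y4; lia.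
  apply: (@integral_quadratic int R[i] intr 1 t%:Z).
  rewrite /bq !rmorph0 fmorph_div rmorph1 /= ratr_nat -pmulrn.
  have e : al ^+ 2 = 1 + 4 * t%:R by rewrite al2 tE natrD natrM.
  transitivity ((1 + 2 * al + al ^+ 2) / 4); first by field.
  by rewrite e; field.
have ibe : int_elt (elt (1 / 2) 0 (1 / 2) 0).
  have [t tE] : exists t : nat, (x * z = 3 + 4 * t)%N.
    by exists ((x * z) %/ 4)%N; rewrite {1}(divn_eq (x * z) 4) -modnMm x4 z4; lia.
  apply: (@integral_quadratic int R[i] intr 1 (- (1 + t)%:Z)).
  rewrite /bq !rmorph0 fmorph_div rmorph1 /= ratr_nat rmorphN /= -pmulrn natrD.
  have e : be ^+ 2 = - (3 + 4 * t%:R) by rewrite be2 tE natrD natrM.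
  transitivity ((1 + 2 * be + be ^+ 2) / 4); first by field.
  by rewrite e; field.
have iga : int_elt ga.
  apply: (@integral_quadratic int R[i] intr 0 (- (y * z)%:Z)).
  have [_ _ _ ->] := bq_relations x0 al2 be2.
  by rewrite rmorph0 mul0r add0r rmorphN /= -pmulrn natrM.
case: k => [[|[|[|[|k]]]] hk] //; rewrite /int_basis /=.
  by rewrite bq1; exact: integral1.
have [t tE] : exists t : nat, (x = 1 + 4 * t)%N.
  by exists (x %/ 4)%N; rewrite {1}(divn_eq x 4) x4; lia.
have -> : elt (1 / 4) (1 / 4) (1 / 4) (1 / 4) =
    elt (1 / 2) (1 / 2) 0 0 * elt (1 / 2) 0 (1 / 2) 0 - t%:R * ga.
  have xC : x%:R = 1 + 4 * t%:R :> R[i] by rewrite [in LHS]tE natrD natrM.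
  have [r1 _ _ _] := bq_relations x0 al2 be2.
  rewrite /bq !rmorph0 !fmorph_div rmorph1 /= !ratr_nat.
  move: r1; set g := ga; rewrite xC => r1.
  transitivity ((1 + al + be + (al * be)) / 4 - t%:R * g).
    by rewrite r1; field.
  by field.
apply: integral_sub; first exact: integral_mul.
by apply: integral_mul => //; exact: integral_nat.
Qed.

Lemma int_basis_sum (c : {ffun 'I_4 -> int}) :
  \sum_(k < 4) (c k)%:~R * int_basis k =
  (let C k := (c (inord k))%:~R in
   elt (C 0%N + C 1%N / 2 + C 2%N / 2 + C 3%N / 4) (C 1%N / 2 + C 3%N / 4)
       (C 2%N / 2 + C 3%N / 4) (C 3%N / 4)).
Proof.
have -> : \sum_(k < 4) (c k)%:~R * int_basis k =
    \sum_(k < 4) (c (inord k))%:~R * int_basis k.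
  by apply: eq_bigr => k _; rewrite inord_val.
rewrite !big_ord_recl big_ord0 addr0 /= /bump /= !(addn0, add0n, add1n) /int_basis /=.
rewrite -!(ratr_int R[i]) !(bq_rat x al be) !(bqM x0 al2 be2) !bqD.
by congr (bq _ _ _ _ _ _ _); field.
Qed.

(** Subtracting [4e] times the last vector removes the [ga] coordinate. Traces then show that [2b']
    and [2c'] are integers, so multiples of the two halves can be subtracted; what remains is
    rational and integral. *)
Lemma int_basisP : is_basis (intr : int -> R[i]) (integers_of K)
  (fun k : 'I_4 => int_basis k).
Proof.
split=> [k|w].
  split; last exact: integral_int_basis.
  by case: k => [[|[|[|[|k]]]] hk] //; exact: bq_in.
move=> [[a [b [c [e wE]]]] iw]; rewrite wE in iw *.
have [_ _ _ /intrP[E eE]] := integral_coords x0 z0 sxy xy1 al2 be2 sxz syz iw.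
have i3 : int_elt (elt (1 / 4) (1 / 4) (1 / 4) (1 / 4)).
  exact: (integral_int_basis (Ordinal (isT : 3 < 4)%N)).
have iE : int_elt (E%:~R : R[i]) by exact: integral_id.
have := integral_sub iw (integral_mul iE i3).
rewrite -(ratr_int R[i]) -eE (bq_rat x al be) (bqM x0 al2 be2) bqB.
set a' := (X in elt X); set b' := (X in elt _ X); set c' := (X in elt _ _ X).
rewrite (_ : e - _ = 0); last by field.
move=> iw'.
have flip := integral_flip x0 z0 sxy xy1 al2 be2.
have := integral_add iw' (flip false true _ _ _ _ iw').
have := integral_add iw' (flip true false _ _ _ _ iw').
have := integral_add iw' (flip true true _ _ _ _ iw').
rewrite !bqD /= !expr0 !expr1 !mul1r !mulN1r !oppr0 !addr0 !subrr => i1 i2 i3'.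
have [A aE] : exists A : int, a' + a' = A%:~R by apply/intrP/integral_ratl/i1.
have ib : b' + b' \is a Num.int.
  have := integral_sub i3' i1; rewrite bqB !subrr subr0 => h.
  have := integral_mul h h; rewrite (bqM x0 al2 be2) !(mul0r, mulr0, addr0, subr0, add0r).
  by move=> /integral_ratl; rewrite -natrM -expr2; exact: squarefree_rat_int.
have ic : c' + c' \is a Num.int.
  have := integral_sub i2 i1; rewrite bqB !subrr subr0 => h.
  have := integral_mul h h; rewrite (bqM x0 al2 be2) !(mul0r, mulr0, addr0, subr0, add0r).
  move=> /integral_ratl; rewrite -natrM -expr2 rpredN; exact: squarefree_rat_int.
have /intrP[B bE] := ib; have /intrP[C cE] := ic.
have ia : a' - b' - c' \is a Num.int.
  have j1 : int_elt (elt (1 / 2) (1 / 2) 0 0).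
    exact: (integral_int_basis (Ordinal (isT : 1 < 4)%N)).
  have j2 : int_elt (elt (1 / 2) 0 (1 / 2) 0).
    exact: (integral_int_basis (Ordinal (isT : 2 < 4)%N)).
  have iB : int_elt (B%:~R : R[i]) by exact: integral_id.
  have iC : int_elt (C%:~R : R[i]) by exact: integral_id.
  have := integral_sub (integral_sub iw' (integral_mul iB j1)) (integral_mul iC j2).
  rewrite -!(ratr_int R[i]) -bE -cE !(bq_rat x al be) !(bqM x0 al2 be2) !bqB => h.
  apply: (@integral_ratl _ x al be).
  set w' := elt _ _ _ _ in h; suff -> : elt (a' - b' - c') 0 0 0 = w' by [].
  by rewrite /w'; congr (bq _ _ _ _ _ _ _); field.
have /intrP[D dE] := ia.
have a'E : a' = a - e by rewrite /a'; field.
have b'E : b' = b - e by rewrite /b'; field.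
have c'E : c' = c - e by rewrite /c'; field.
exists [ffun k : 'I_4 => [:: D; B; C; E]`_k]; split.
  rewrite int_basis_sum; cbv beta zeta; rewrite !ffunE !inordK //=.
  rewrite -dE -bE -cE -eE a'E b'E c'E.
  by congr (bq _ _ _ _ _ _ _); field.
move=> f; rewrite int_basis_sum => /(bq_inj x0 z0 sxy xy1 al2 be2) /=.
case=> f0 f1 f2 f3; apply/ffunP => k; rewrite ffunE.
have -> : f k = f (inord k) by rewrite inord_val.
apply: (@intr_inj rat).
case: k => [[|[|[|[|k]]]] hk] //=; rewrite -?dE -?bE -?cE -?eE ?a'E ?b'E ?c'E; lra.
Qed.

(** Another system of embeddings permutes the rows, and another integral basis multiplies by a
    matrix of determinant 1 or -1; squaring removes both signs. *)
Lemma disc_bq : disc K = ((x * y * z) ^ 2)%:Z.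
Proof.
have bE := bq_embeddings x0 z0 sxy xy1 al2 be2.
apply: xget_unique.
  exists 4%N, (fun k => int_basis k), (fun i => bq_map x al be (odd i) (1 < i)%N).
  by split; [exact: int_basisP | exact: bE | rewrite det_int_basis -pmulrn].
move=> d [n [e [s [eB sE dE]]]].
pose same (t u : R[i] -> R[i]) := forall w, K w -> t w = u w.
have same_sym t u : same t u -> same u t by move=> h w Kw; rewrite h.
have same_trans t u v : same t u -> same u v -> same t v.
  by move=> h1 h2 w Kw; rewrite h1 // h2.
have n4 := transversal_card same_sym same_trans (sE : transversal (embedding K) same s) bE.
subst n.
have [f finj fE] :=
  transversal_inj same_sym same_trans (bE : transversal (embedding K) same _) sE.
have [P P1 PE] := basis_change eB int_basisP.
have Kb (j : 'I_4) : K (int_basis j) by case: int_basisP => /(_ j)[].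
apply: (@intr_inj R[i]); rewrite dE -pmulrn -det_int_basis.
set S := \matrix_(i, j) _; set S0 := \matrix_(i, j) _.
have -> : S = row_perm (perm finj) S0 *m map_mx intr P.
  apply/matrixP => i j; rewrite !mxE fE; last first.
    by case: eB => /(_ j)[].
  rewrite PE (embedding_sum _ Ksub (bE.1 (f i))); last by move=> k; exact: Kb.
  by apply: eq_bigr => k _; rewrite !mxE permE mulrC.
rewrite det_mulmx det_map_mx exprMn -rmorphXn /= P1 mulr1.
by rewrite row_permE det_mulmx det_perm exprMn sqrr_sign mul1r.
Qed.

End Discriminant.

(** * Fields with prescribed unit group *)

Definition biquad_params (x y z : nat) : Prop :=
  [/\ [/\ x %% 4 = 1, y %% 4 = 1 & z %% 4 = 3],
      [/\ 16 < x * y, 16 < x * z & 16 < y * z] &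
      [/\ squarefree (x * y), squarefree (x * z) & squarefree (y * z)]]%N.

Section BiquadraticFields.
Variables (R : realType).

(* [Q(sqrt(xy), sqrt(-xz))], whose third quadratic subfield is [Q(sqrt(-yz))]. *)
Definition biquad (x y z : nat) : set R[i] :=
  bq_field x (sqrtC (x * y)%:R) (sqrtC (- (x * z)%:R)).

Lemma biquad_imaginary x y z :
  biquad_params x y z -> imaginary_biquadratic (biquad x y z).
Proof.
case=> -[x4 y4 z4] [xy16 xz16 yz16] [sxy sxz syz].
have x0 : (0 < x)%N by case: x x4 {xy16 xz16 sxy sxz}.
have z0 : (0 < z)%N by case: z z4 {yz16 xz16 syz sxz}.
have xy1 : (1 < x * y)%N by exact: leq_trans xy16.
have al2 := sqrtCK ((x * y)%:R : R[i]); have be2 := sqrtCK (- (x * z)%:R : R[i]).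
have Kdeg : has_degree (biquad x y z) 4.
  by exists (bq_basis x (sqrtC (x * y)%:R) (sqrtC (- (x * z)%:R)));
     exact: (bq_is_basis x0 z0 sxy xy1 al2 be2).
split; last first.
  move=> /(_ _ (bq_in_be x _ _))/CrealP; rewrite (be_imaginary x0 z0 be2) => /eqP.
  rewrite eq_sym -subr_eq0 opprK -mulr2n mulrn_eq0 /=.
  exact/negP/(be_neq0 x0 z0 be2).
split; first by split; [exact: (bq_subfield x0 z0 sxy xy1 al2 be2) | exists 4%N].
split=> //; exists (x * y)%:R, (- (x * z)%:R).
rewrite rmorphN /= !ratr_nat.
exact: (bq_field_adjoin2 x0 z0 sxy xy1 al2 be2).
Qed.

Lemma biquad_disc x y z :
  biquad_params x y z -> disc (biquad x y z) = ((x * y * z) ^ 2)%:Z.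
Proof.
case=> -[x4 y4 z4] [xy16 xz16 yz16] [sxy sxz syz].
have x0 : (0 < x)%N by case: x x4 {xy16 xz16 sxy sxz}.
have z0 : (0 < z)%N by case: z z4 {yz16 xz16 syz sxz}.
have xy1 : (1 < x * y)%N by exact: leq_trans xy16.
exact: (disc_bq x0 z0 sxy sxz syz xy1 x4 y4 z4 (sqrtCK _) (sqrtCK _)).
Qed.

Lemma biquad_units x y z : biquad_params x y z ->
  units_of (biquad x y z) = real_units (sqrtC (x * y)%:R).
Proof.
case=> -[x4 y4 z4] [xy16 xz16 yz16] [sxy sxz syz].
have x0 : (0 < x)%N by case: x x4 {xy16 xz16 sxy sxz}.
have z0 : (0 < z)%N by case: z z4 {yz16 xz16 syz sxz}.
exact: (units_of_bq x0 z0 sxy sxz syz xy16 xz16 yz16 z4 (sqrtCK _) (sqrtCK _)).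
Qed.

Lemma biquad_reg x y z (eps : R[i]) : biquad_params x y z ->
  units_of (biquad x y z) eps -> 1 < Normc.normc eps ->
  (forall u, units_of (biquad x y z) u ->
    exists n : int, Normc.normc u = Normc.normc eps ^ n) ->
  reg (biquad x y z) = 2 * ln (Normc.normc eps).
Proof.
case=> -[x4 y4 z4] [xy16 xz16 yz16] [sxy sxz syz].
have x0 : (0 < x)%N by case: x x4 {xy16 xz16 sxy sxz}.
have z0 : (0 < z)%N by case: z z4 {yz16 xz16 syz sxz}.
exact: (reg_bq x0 z0 sxy sxz syz xy16 xz16 yz16 z4 (sqrtCK _) (sqrtCK _)).
Qed.

Lemma biquad_gap (m x y z : nat) (u : R[i]) : biquad_params x y z ->
  (m <= x * y)%N -> (m <= x * z)%N -> (m <= y * z)%N ->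
  units_of (biquad x y z) u -> 1 < Normc.normc u ->
  m%:R / 8 - 1 <= Normc.normc u ^+ 2.
Proof.
case=> -[x4 y4 z4] [xy16 xz16 yz16] [sxy sxz syz].
have x0 : (0 < x)%N by case: x x4 {xy16 xz16 sxy sxz}.
have z0 : (0 < z)%N by case: z z4 {yz16 xz16 syz sxz}.
exact: (unit_gap x0 z0 sxy sxz syz xy16 xz16 yz16 z4 (sqrtCK _) (sqrtCK _)).
Qed.

(** The Pell solution yields the unit [n + f al], with inverse [n - f al]; its modulus is not 1,
    because [n^2 + xy f^2] exceeds 1. So the discrete group of moduli is nontrivial. *)
Lemma biquad_fundamental_unit x y z (n f : nat) : biquad_params x y z ->
  (0 < f)%N -> (n ^ 2 = x * y * f ^ 2 + 1)%N ->
  exists eps, [/\ units_of (biquad x y z) eps, 1 < Normc.normc eps &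
    forall u, units_of (biquad x y z) u ->
      exists k : int, Normc.normc u = Normc.normc eps ^ k].
Proof.
move=> P f0 pell.
have [[x4 y4 z4] [xy16 xz16 yz16] [sxy sxz syz]] := P.
have x0 : (0 < x)%N by case: x x4 {P pell xy16 xz16 sxy sxz}.
have z0 : (0 < z)%N by case: z z4 {P yz16 xz16 syz sxz}.
have xy1 : (1 < x * y)%N by exact: leq_trans xy16.
have al2 := sqrtCK ((x * y)%:R : R[i]); have be2 := sqrtCK (- (x * z)%:R : R[i]).
set al := sqrtC _ in al2; set be := sqrtC _ in be2.
pose K := biquad x y z; have Ksub : is_subfield K.
  exact: (bq_subfield x0 z0 sxy xy1 al2 be2).
have pellC : n%:R ^+ 2 - (x * y)%:R * f%:R ^+ 2 = 1 :> R[i].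
  by rewrite -!natrX -natrM pell natrD addrAC subrr add0r.
pose u := bq x al be n%:R f%:R 0 0; pose v := bq x al be n%:R (- f%:R) 0 0.
have uE : u = n%:R + f%:R * al by rewrite /u /bq !ratr_nat !rmorph0 !mul0r !addr0.
have vE : v = n%:R - f%:R * al.
  by rewrite /v /bq rmorphN /= !ratr_nat !rmorph0 !mul0r !addr0 mulNr.
have uv : u * v = 1.
  by rewrite uE vE -[RHS]pellC -al2; ring.
have u0 : u != 0 by apply/eqP => u0; move/eqP: uv; rewrite u0 mul0r eq_sym oner_eq0.
have vV : u^-1 = v by apply: (mulfI u0); rewrite divff.
have quad (w w' : R[i]) : w + w' = (2 * n)%:R -> w * w' = 1 ->
    integralOver (intr : int -> R[i]) w.
  move=> s p; apply: (@integral_quadratic int R[i] intr (2 * n)%:Z (-1)).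
  rewrite rmorphN1 /= -[_%:~R]/((2 * n)%:R) -s.
  transitivity ((w + w') * w - w * w'); first by ring.
  by rewrite p.
have uu : units_of K u.
  split=> //; [split; [exact: bq_in|] | rewrite vV; split; [exact: bq_in|]].
    by apply: (quad u v) => //; rewrite uE vE natrM; ring.
  by apply: (quad v u); [rewrite uE vE natrM; ring | rewrite mulrC].
have nu : Normc.normc u != 1.
  apply/eqP => nu1.
  have := unit_qform x0 z0 sxy xy16 al2 be2 uu.
  rewrite nu1 expr1n invr1 => /esym; rewrite -[1 + 1](ratr_nat R 2) => /fmorph_inj.
  rewrite /qform !expr0n !mulr0 !addr0 -!natrX -!natrM -!natrD -natrM => /eqP.
  by rewrite eqr_nat pell; nia.
(* Any constant above 1 with square at most [17/8 - 1 = 9/8], the gap for [m = 17], would do. *)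
have [] := @discrete_group_cyclic R [set Normc.normc w | w in units_of K] (33 / 32).
- lra.
- move=> _ [w [_ w0 _] <-].
  by rewrite lt_neqAle eq_sym normc_eq0 w0 normc_ge0.
- move=> _ _ [w uw <-] [w' uw' <-]; exists (w / w'); last first.
    by rewrite Normc.normcM Normc.normcV.
  exact: (units_div x0 z0 sxy xy16 al2 be2 uw uw').
- move=> _ [w uw <-] w1.
  have := biquad_gap P xy16 xz16 yz16 uw w1.
  move=> h; rewrite -(ler_pXn2r (n := 2)) ?nnegrE ?normc_ge0 //; first by lra.
- have [n1|n1|n1] := ltgtP (Normc.normc u) 1.
  + exists (Normc.normc u^-1).
      by exists u^-1 => //; exact: (unitsV x0 z0 sxy xy16 al2 be2 uu).
    rewrite Normc.normcV invf_gt1 // lt_neqAle eq_sym normc_eq0 u0.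
    exact: normc_ge0.
  + by exists (Normc.normc u) => //; exists u.
  + by rewrite n1 eqxx in nu.
move=> _ [[eps ue <-] e1 egen]; exists eps; split=> // w uw.
by apply: egen; exists w.
Qed.

(** A square root of [-z] in [K(x,y,z)] is imaginary, hence of the form [c be + e ga]. Squaring
    gives [c e = 0] and [x c^2 + y e^2 = 1], which forces [x] or [y] to be 1. *)
Lemma biquad_neq x y z : biquad_params 1 (x * y) z -> biquad_params x y z ->
  (1 < x)%N -> (1 < y)%N -> biquad 1 (x * y) z <> biquad x y z.
Proof.
move=> [[_ _ z4] _ [_ sz _]] [_ [xy16 _ _] [sxy _ _]] x1 y1 KK.
have z0 : (0 < z)%N by case: z z4 {KK sz}.
have x0 := ltnW x1; have xy1 : (1 < x * y)%N by exact: leq_trans xy16.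
have al2 := sqrtCK ((x * y)%:R : R[i]); have be2 := sqrtCK (- (x * z)%:R : R[i]).
have de2 := sqrtCK (- (1 * z)%:R : R[i]).
have := bq_in_be 1 (sqrtC (1 * (x * y))%:R) (sqrtC (- (1 * z)%:R : R[i])).
rewrite -/(biquad 1 (x * y) z) KK => -[a [b [c [e dE]]]].
have := be_imaginary (isT : 0 < 1)%N z0 de2; rewrite dE (bq_conj x0 z0 al2 be2).
move=> h; have /(bq_eq0 x0 z0 sxy xy1 al2 be2)[a0 b0 _ _] :
    bq x (sqrtC (x * y)%:R) (sqrtC (- (x * z)%:R))
      (a + a) (b + b) (- c + c) (- e + e) = 0 :> R[i].
  by rewrite -bqD h addNr.
have {}a0 : a = 0 by lra.
have {}b0 : b = 0 by lra.
move: de2; rewrite dE expr2 (bqM x0 al2 be2) mul1n -(ratr_nat R[i] z) -rmorphN /=.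
rewrite (bq_rat x (sqrtC (x * y)%:R) (sqrtC (- (x * z)%:R))).
move=> /(bq_inj x0 z0 sxy xy1 al2 be2)[]; rewrite a0 b0 => e1 e2 _ _.
have zq : z%:R != 0 :> rat by rewrite pnatr_eq0 -lt0n.
have ce : c * e = 0.
  have : z%:R * (c * e) = 0 by lra.
  by move/eqP; rewrite mulf_eq0 (negPf zq) => /eqP.
have xye : x%:R * c ^+ 2 + y%:R * e ^+ 2 = 1.
  by apply: (mulfI zq); lra.
have sx := squarefree_dvd sxy (dvdn_mulr y (dvdnn x)).
have sy := squarefree_dvd sxy (dvdn_mull x (dvdnn y)).
move/eqP: ce; rewrite mulf_eq0 => /orP[] /eqP ce0; move: xye; rewrite ce0 expr0n mulr0.
  by rewrite add0r => /(squarefree_rat_sqr sy) y1'; rewrite y1' in y1.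
by rewrite addr0 => /(squarefree_rat_sqr sx) x1'; rewrite x1' in x1.
Qed.

End BiquadraticFields.

(** * The infinite families of fields and pairs *)

Lemma infinite_set_unbounded (T : Type) (A : set T) (f : T -> nat) :
  (forall N, exists2 t, A t & (N < f t)%N) -> infinite_set A.
Proof.
move=> unb /(finite_image f)/finite_seqP[s sE].
have [t At] := unb (\max_(i <- s) i)%N; apply/negP; rewrite -leqNgt.
have : [set f u | u in A] (f t) by exists t.
by rewrite sE /= => fs; apply: leq_bigmax_seq fs _.
Qed.

Lemma biquad_params_prime (m x y z : nat) : (16 <= m)%N -> (m < x)%N -> (1 < y)%N ->
  (x %% 4 = 1)%N -> (y %% 4 = 1)%N -> squarefree (x * y) ->
  (x * y < z)%N -> prime z -> (z %% 4 = 3)%N ->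
  biquad_params x y z /\ biquad_params 1 (x * y) z.
Proof.
move=> m16 mx y1 x4 y4 sxy xyz pz z4.
have cop w : (0 < w)%N -> (w <= x * y)%N -> coprime w z.
  move=> w0 wle; rewrite coprime_sym prime_coprime //.
  by apply/negP => /(dvdn_leq w0); lia.
have sz := squarefree_prime pz.
have sx := squarefree_dvd sxy (dvdn_mulr y (dvdnn x)).
have sy := squarefree_dvd sxy (dvdn_mull x (dvdnn y)).
have xxy : (x <= x * y)%N by rewrite leq_pmulr // ltnW.
have yxy : (y <= x * y)%N by rewrite leq_pmull // (leq_trans _ mx).
have x0 : (0 < x)%N by exact: leq_ltn_trans mx.
have y0 := ltnW y1; have z16 : (16 < z)%N by lia.
have xy0 : (0 < x * y)%N by rewrite muln_gt0 x0.
have big w : (0 < w)%N -> (16 < w * z)%N.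
  by move=> w0; rewrite (leq_trans z16) // leq_pmull.
split; split; rewrite ?mul1n; split=> //.
- lia.
- exact: big.
- exact: big.
- by apply: squarefree_mul => //; exact: cop.
- by apply: squarefree_mul => //; exact: cop.
- by rewrite -modnMm x4 y4.
- lia.
- exact: big.
- by apply: squarefree_mul => //; exact: cop.
Qed.

Theorem theorem1p2 (R : realType) (M : R) (hM : 0 < M) :
  exists r : R, M < r /\
    infinite_set [set K : set R[i] | imaginary_biquadratic K /\ reg K = r] /\
    infinite_set [set P : set R[i] * set R[i] |
      [/\ imaginary_biquadratic P.1, imaginary_biquadratic P.2 & P.1 <> P.2] /\
      [/\ disc P.1 = disc P.2, reg P.1 = r & reg P.2 = r]].
Proof.
(* The first summand gives [m / 8 - 1 > exp M], and the gap bounds [|eps|^2] below by [m / 8 - 1],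
   so the regulator [ln |eps|^2] exceeds [M]. The summand 16 ensures [xy > 16]. *)
pose m := ((Num.truncn (8 * (expR M + 1))).+1 + 16)%N.
have m16 : (16 <= m)%N by rewrite leq_addl.
have mM : expR M < m%:R / 8 - 1.
  have := truncnS_gt (8 * (expR M + 1)); rewrite /m natrD; lra.
have [x [y [n [f [[mx y1 x4 y4] sxy f0 pell]]]]] := pell_parameters m.
have params z := @biquad_params_prime m x y z m16 mx y1 x4 y4 sxy.
have [p [xyp pp p4]] := prime_3mod4_above (x * y).
have [Pp _] := params p xyp pp p4.
have [eps [ue e1 egen]] := biquad_fundamental_unit R Pp f0 pell.
(* All these fields have the same set of units as the reference field with [z = p], so the one [eps]
   found there serves for each of them. *)
have regE z : (x * y < z)%N -> prime z -> (z %% 4 = 3)%N ->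
    reg (@biquad R x y z) = 2 * ln (Normc.normc eps) /\
    reg (@biquad R 1 (x * y) z) = 2 * ln (Normc.normc eps).
  move=> xyz pz z4; have [P P1] := params z xyz pz z4.
  split; apply: biquad_reg => //; rewrite biquad_units // ?mul1n -(biquad_units R Pp) //.
have x0 : (0 < x)%N by exact: leq_ltn_trans mx.
have xxy : (x <= x * y)%N by rewrite leq_pmulr // ltnW.
have mxy : (m <= x * y)%N by exact: leq_trans (ltnW mx) xxy.
have mp : (m <= p)%N by exact: leq_trans mxy (ltnW xyp).
exists (2 * ln (Normc.normc eps)); split.
  have : m%:R / 8 - 1 <= Normc.normc eps ^+ 2.
    apply: (biquad_gap Pp mxy _ _ ue e1); apply: (leq_trans mp).
      by rewrite leq_pmull.
    by rewrite leq_pmull // ltnW.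
  move=> /(lt_le_trans mM) lt_eps.
  have e0 : 0 < Normc.normc eps by exact: lt_trans e1.
  by rewrite mulr_natl -lnXn // -ltr_expR lnK // posrE exprn_gt0.
have pairs N : exists z, [/\ (N < z)%N, biquad_params x y z, biquad_params 1 (x * y) z,
    reg (@biquad R x y z) = 2 * ln (Normc.normc eps) &
    reg (@biquad R 1 (x * y) z) = 2 * ln (Normc.normc eps)].
  have [z [zN pz z4]] := prime_3mod4_above (x * y + N).
  have xyz : (x * y < z)%N by exact: leq_ltn_trans (leq_addr _ _) zN.
  have [P P1] := params z xyz pz z4; have [r1 r2] := regE z xyz pz z4.
  by exists z; split=> //; exact: leq_ltn_trans (leq_addl _ _) zN.
(* The discriminant grows with [z] and so takes unboundedly large values, which makes both families
   infinite. *)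
have big z : (z <= (x * y * z) ^ 2)%N.
  have xy0 : (0 < x * y)%N by exact: leq_trans xxy.
  have [->//|z0] := posnP z; have zxyz : (z <= x * y * z)%N by rewrite leq_pmull.
  by rewrite (leq_trans zxyz) // -mulnn leq_pmulr // (leq_trans z0).
split.
  apply: (@infinite_set_unbounded _ _ (fun K => `|disc K|%N)) => N.
  have [z [zN P _ rz _]] := pairs N.
  exists (@biquad R x y z); first by split; [exact: biquad_imaginary|].
  by rewrite biquad_disc // absz_nat (leq_trans zN).
apply: (@infinite_set_unbounded _ _ (fun P => `|disc P.1|%N)) => N.
have [z [zN P P1 rz rz1]] := pairs N.
exists (@biquad R 1 (x * y) z, @biquad R x y z); last first.
  by rewrite /= biquad_disc // absz_nat mul1n (leq_trans zN).
split; split=> //=; try exact: biquad_imaginary.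
  by apply: biquad_neq => //; lia.
by rewrite !biquad_disc // mul1n.
Qed.
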